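(* As $n \to \infty$, $$\left[b^{\lfloor (n-1)/2 \rfloor} a^{\lceil (n-1)/2 \rceil}\right] = \left( \frac{1}{2 \log 2\sqrt{1 - \log 2}} + o(1) \right) \left( \frac{1}{2 \log 2} \right)^n n!.$$
   Context: Let $S_n$ be the set of permutations of $[n]=\{1,\dots,n\}$. For $\pi \in S_n$, an index $i \in [n-1]$ is an excedance of $\pi$ if $\pi(i) > i$. The excedance word of $\pi$ is $w(\pi) = (w_1,\dots,w_{n-1}) \in \{a,b\}^{n-1}$ with $w_i = b$ if $\pi(i) > i$ and $w_i = a$ if $\pi(i) \le i$. For a word $w \in \{a,b\}^{n-1}$, $[w]$ denotes the number of $\pi \in S_n$ with $w(\pi) = w$. For non-negative integers $r+s=n-1$, $b^r a^s$ denotes the word whose first $r$ letters are $b$ and last $s$ letters are $a$; thus $[b^r a^s]$ is the number of $\pi\in S_n$ such that $\pi(i)>i$ holds exactly for $i \in \{1,\dots,r\}$ among $i\in[n-1]$. *)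

(* Defs.v *)
From mathcomp Require Import all_boot all_fingroup.
From Stdlib Require Import Reals.

Set Implicit Arguments.
Unset Strict Implicit.
Unset Printing Implicit Defensive.

(* Permutations of [n] are modelled by 'S_n acting on 'I_n = {0,...,n-1};
   the 0-based index i corresponds to the 1-based index i+1, so
   "pi(i+1) > i+1" becomes "s i > i", and "i+1 in [n-1]" becomes "i < n-1". *)

(* excedance word value: true = letter b (excedance), false = letter a *)
Definition exc_word (n : nat) (s : 'S_n) (i : 'I_n) : bool := (i < s i)%N.

(* [b^r a^s] with r + s = n - 1: number of permutations of [n] whose
   excedances among indices 1..n-1 are exactly 1..r. *)
Definition count_bras (n r : nat) : nat :=
  #|[set s : 'S_n | [forall i : 'I_n,
        (i < n.-1)%N ==> (exc_word s i == (i < r)%N)]]|.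

(* Main.v *)
(* Deleting the first forced non-excedance gives a linear recursion which shows
   that the exponential generating function of [b^r a^s], in variables x for r and
   y for s, is F = 1 / (2 cosh v - e^u)^2 where x = u + v and y = u - v. For
   r + s = N and s - r in {0, 1} the derivative of order (r, s) is, up to 2^-N,
   (D_u^2 - D_v^2)^r (D_u - D_v)^(s - r), so [b^r a^s] is a sum over j of multiples
   of (-1)^j binom(r, j) D_u^(N - 2j) D_v^(2j) F(0). These are all nonnegative:
   the coefficient of v^(2j) in 1 / (2 cos v - e^u) lies between
   psi^(j+1) - (j/12) psi^j and psi^(j+1), where psi = 1 / (2 - e^u).
   By the renewal theorem for the law L^k / k! (k > 0, L = ln 2), of mean 2L, the
   coefficients of powers of psi are known asymptotically. After normalization the
   j-th term tends to binom(2j, j) (L/4)^j and is at most 4 L^2 (2 L^2)^j, with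
   2 L^2 < 1; dominated convergence and the central binomial series
   sum_j binom(2j, j) (L/4)^j = 1 / sqrt(1 - L) conclude. *)
Require Import Defs.
From HB Require Import structures.
From mathcomp Require Import all_boot all_fingroup all_order all_algebra.
From mathcomp Require Import boolp classical_sets reals topology normedtype.
From mathcomp Require Import sequences exp Rstruct Rstruct_topology.
From mathcomp Require Import zify ring lra.

Set Implicit Arguments.
Unset Strict Implicit.
Unset Printing Implicit Defensive.

Import Order.TTheory GRing.Theory Num.Theory.
Import numFieldTopology.Exports numFieldNormedType.Exports.

(** * Counting by excedance words *)

(* [Q p b] constrains position [p], [b] telling whether [p] is an excedance. *)
Definition exc_count (m : nat) (Q : nat -> bool -> bool) : nat :=
  #|[set s : 'S_m | [forall p : 'I_m, Q p (p < s p)]]|.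

Lemma exc_count_ext (m : nat) (Q Q' : nat -> bool -> bool) :
  (forall p b, p < m -> Q p b = Q' p b) -> exc_count m Q = exc_count m Q'.
Proof.
move=> QQ'; apply: eq_card => s; rewrite !inE.
by apply: eq_forallb => p; rewrite QQ'.
Qed.

(* The position [i] takes one of the [i.+1] values at most [i]; deleting it and
   its image leaves the later positions' excedance status unchanged. *)
Lemma exc_count_nonexc (m i : nat) (Q : nat -> bool -> bool) :
  i <= m -> (forall p b, p < i -> Q p b) -> (forall b, Q i b = ~~ b) ->
  exc_count m.+1 Q
  = i.+1 * exc_count m (fun p b => (p < i) || Q p.+1 b).
Proof.
move=> le_im Qlt Qi; have lt_im : i.+1 <= m.+1 by [].
pose i0 : 'I_m.+1 := Ordinal lt_im.
set Q' := fun p b => _.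
pose g (u : 'I_i.+1 * 'S_m) : 'S_m.+1 := lift_perm i0 (widen_ord lt_im u.1) u.2.
have g_inj : injective g.
  move=> [j s] [j' s'] /= gE.
  have jE : j = j'.
    apply: val_inj; have := congr1 (fun t : 'S_m.+1 => val (t i0)) gE.
    by rewrite /g /= !lift_perm_id.
  rewrite -jE in gE *; congr pair; apply/permP => k.
  have := congr1 (fun t : 'S_m.+1 => t (lift i0 k)) gE.
  by rewrite /g /= !lift_perm_lift => /lift_inj.
have gP j s (k : 'I_m) : i <= k ->
    (lift i0 k < g (j, s) (lift i0 k)) = (k < s k).
  move=> le_ik; rewrite /g lift_perm_lift /= /bump le_ik.
  have := ltn_ord j; case: leqP => /=; lia.
rewrite /exc_count -[i.+1 in RHS]card_ord -cardsT -cardsX -(card_imset _ g_inj).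
apply: eq_card => t; rewrite inE; apply/forallP/imsetP.
- move=> tQ.
  have le_ti : t i0 < i.+1 by have := tQ i0; rewrite Qi /= -leqNgt.
  have [s sE] : exists s, t = g (Ordinal le_ti, s).
    have tK (k : 'I_m) : t i0 != t (lift i0 k).
      by rewrite (inj_eq perm_inj) neq_lift.
    pose f k := odflt k (unlift (t i0) (t (lift i0 k))).
    have fE k : lift (t i0) (f k) = t (lift i0 k).
      by rewrite /f; case: (unlift_some (tK k)) => j -> ->.
    have f_inj : injective f.
      by move=> k k' /(congr1 (lift (t i0))); rewrite !fE => /perm_inj/lift_inj.
    exists (perm f_inj); apply/permP => k; rewrite /g /=.
    have -> : widen_ord lt_im (Ordinal le_ti) = t i0 by apply: val_inj.
    case: (unliftP i0 k) => [k'|] ->; last by rewrite lift_perm_id.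
    by rewrite lift_perm_lift permE fE.
  exists (Ordinal le_ti, s) => //; rewrite !inE /=; apply/forallP => k.
  rewrite /Q'; case: ltnP => //= le_ik.
  have := tQ (lift i0 k); rewrite sE gP //.
  by rewrite /= /bump le_ik.
- case=> -[j s]; rewrite !inE /= => /forallP sQ -> p.
  case: (unliftP i0 p) => [k|] ->.
    have [lt_ki|le_ik] := ltnP k i.
      by apply: Qlt; rewrite /= /bump; have -> : (i <= k) = false by lia.
    rewrite gP //= /bump le_ik; have := sQ k.
    by rewrite /Q' ltnNge le_ik.
  by rewrite Qi /g /= lift_perm_id /= -leqNgt -ltnS ltn_ord.
Qed.

(* The first [i] positions and the last one are free; in between come [r]
   excedances followed by [s] non-excedances. *)
Definition bras_pat (i r s p : nat) (e : bool) : bool :=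
  (i <= p < i + r + s) ==> (e == (p < i + r)).

Definition bras_count (i r s : nat) : nat :=
  exc_count (i + r + s).+1 (bras_pat i r s).

Lemma bras_count00 (i : nat) : bras_count i 0 0 = i.+1`!.
Proof.
rewrite /bras_count /exc_count !addn0 -card_Sn; apply: eq_card => s.
rewrite inE; apply/forallP => p; rewrite /bras_pat !addn0.
by apply/implyP; lia.
Qed.

Lemma bras_count0S (i s : nat) :
  bras_count i 0 s.+1 = i.+1 * bras_count i 0 s.
Proof.
rewrite /bras_count addnS (@exc_count_nonexc _ i); first last.
- by move=> b; rewrite /bras_pat addn0 leqnn ltnn; case: b => /=; lia.
- by move=> p b lt_pi; rewrite /bras_pat leqNgt lt_pi.
- lia.
congr (_ * _); apply: exc_count_ext => p b _; rewrite /bras_pat.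
by case: (ltnP p i) b => ? [] /=; lia.
Qed.

(** Position [i] is free on the left. If it is an excedance, the permutation belongs to the first
    summand; otherwise [exc_count_nonexc] deletes it, with [i.+1] choices for its value. *)
Lemma bras_countS (i r s : nat) :
  bras_count i.+1 r s = bras_count i r.+1 s + i.+1 * bras_count i r s.
Proof.
have -> : i.+1 * bras_count i r s =
    exc_count (i.+1 + r + s).+1
      (fun p e => bras_pat i.+1 r s p e && ((p == i) ==> ~~ e)).
  rewrite /bras_count !addSn [RHS](@exc_count_nonexc _ i); first last.
  - by move=> b; rewrite /= /bras_pat ltnn eqxx.
  - move=> p b lt_pi; rewrite /= /bras_pat ltnNge (ltnW lt_pi) /=.
    by rewrite ltn_eqF.
  - lia.
  congr (_ * _); apply: exc_count_ext => p b _; rewrite /bras_pat.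
  by case: (ltnP p i) b => ? [] /=; lia.
have -> : bras_count i r.+1 s =
    exc_count (i.+1 + r + s).+1
      (fun p e => bras_pat i.+1 r s p e && ((p == i) ==> e)).
  rewrite /bras_count !addnS !addSn; apply: exc_count_ext => p b _.
  by rewrite /bras_pat; case: b => /=; lia.
have lt_i : i < (i.+1 + r + s).+1 by lia.
rewrite /bras_count /exc_count.
rewrite -(cardsID [set t : 'S_(i.+1 + r + s).+1 | (i < t (Ordinal lt_i))]).
congr (_ + _); apply: eq_card => t; rewrite !inE.
- apply/andP/forallP => [[/forallP tQ ti] p|tQ].
    rewrite tQ; apply/implyP => /eqP pi.
    by have -> : p = Ordinal lt_i by apply: val_inj.
  have := tQ (Ordinal lt_i); rewrite eqxx /= => /andP[_ ->]; split=> //.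
  by apply/forallP => p; have /andP[] := tQ p.
- apply/andP/forallP => [[ti /forallP tQ] p|tQ].
    rewrite tQ; apply/implyP => /eqP pi.
    by have -> : p = Ordinal lt_i by apply: val_inj.
  have := tQ (Ordinal lt_i); rewrite eqxx /= => /andP[_ ->]; split=> //.
  by apply/forallP => p; have /andP[] := tQ p.
Qed.

Lemma count_brasE (r s : nat) : count_bras (r + s).+1 r = bras_count 0 r s.
Proof.
rewrite /count_bras /bras_count /exc_count !add0n; apply: eq_card => t.
by rewrite !inE; apply: eq_forallb.
Qed.

(** * Formal power series *)

Local Open Scope ring_scope.

Record fps (A : Type) := Fps { fcoef :> nat -> A }.

HB.instance Definition _ (A : Type) := gen_eqMixin (fps A).
HB.instance Definition _ (A : Type) := gen_choiceMixin (fps A).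

Lemma fpsP (A : Type) (f g : fps A) : (forall n, f n = g n) -> f = g.
Proof. by case: f g => [f] [g] /= /funext ->. Qed.

Section FpsRing.
Variable A : comNzRingType.
Implicit Types f g h : fps A.

Definition fps_add f g := Fps (fun n => f n + g n).
Definition fps_opp f := Fps (fun n => - f n).
Definition fps_zero : fps A := Fps (fun=> 0).
Definition fps_one : fps A := Fps (fun n => (n == 0%N)%:R).
Definition fps_mul f g := Fps (fun n => \sum_(i < n.+1) f i * g (n - i)%N).

Fact fps_addA : associative fps_add.
Proof. by move=> f g h; apply: fpsP => n /=; rewrite addrA. Qed.
Fact fps_addC : commutative fps_add.
Proof. by move=> f g; apply: fpsP => n /=; rewrite addrC. Qed.
Fact fps_add0 : left_id fps_zero fps_add.
Proof. by move=> f; apply: fpsP => n /=; rewrite add0r. Qed.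
Fact fps_addN : left_inverse fps_zero fps_opp fps_add.
Proof. by move=> f; apply: fpsP => n /=; rewrite addNr. Qed.

HB.instance Definition _ :=
  GRing.isZmodule.Build (fps A) fps_addA fps_addC fps_add0 fps_addN.

(** Coefficients of a product below [n] depend only on truncations at [n], so associativity,
    commutativity and the Leibniz rule are inherited from polynomials. *)
Definition fps_trunc n f : {poly A} := \poly_(i < n) f i.

Lemma coef_fps_mul n f g k : (k < n)%N ->
  fps_mul f g k = (fps_trunc n f * fps_trunc n g)`_k.
Proof.
move=> lt_kn; rewrite coefM; apply: eq_bigr => i _.
have := ltn_ord i; rewrite !coef_poly ltnS => le_ik.
by rewrite (leq_ltn_trans le_ik) // (leq_ltn_trans (leq_subr _ _)).
Qed.

Lemma coef_mul_trunc n (p q p' q' : {poly A}) k : (k < n)%N ->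
  (forall i, (i < n)%N -> p`_i = p'`_i) ->
  (forall i, (i < n)%N -> q`_i = q'`_i) -> (p * q)`_k = (p' * q')`_k.
Proof.
move=> lt_kn pp' qq'; rewrite !coefM; apply: eq_bigr => i _.
have := ltn_ord i; rewrite ltnS => le_ik; rewrite pp' ?qq' //.
  by rewrite (leq_ltn_trans (leq_subr _ _)).
by rewrite (leq_ltn_trans le_ik).
Qed.

Lemma coef_trunc_mul n f g i : (i < n)%N ->
  (fps_trunc n (fps_mul f g))`_i = (fps_trunc n f * fps_trunc n g)`_i.
Proof. by move=> lt_in; rewrite coef_poly lt_in (coef_fps_mul f g lt_in). Qed.

Fact fps_mulA : associative fps_mul.
Proof.
move=> f g h; apply: fpsP => n; rewrite !(@coef_fps_mul n.+1) //.
transitivity ((fps_trunc n.+1 f * (fps_trunc n.+1 g * fps_trunc n.+1 h))`_n).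
  by apply: (coef_mul_trunc (n := n.+1)) => // i; apply: coef_trunc_mul.
rewrite mulrA; apply: (coef_mul_trunc (n := n.+1)) => // i lt_in.
by rewrite coef_trunc_mul.
Qed.
Fact fps_mulC : commutative fps_mul.
Proof.
by move=> f g; apply: fpsP => n; rewrite !(@coef_fps_mul n.+1) // mulrC.
Qed.
Fact fps_mul1 : left_id fps_one fps_mul.
Proof.
move=> f; apply: fpsP => n /=; rewrite big_ord_recl /= mul1r subn0.
by rewrite big1 ?addr0 // => i _; rewrite mul0r.
Qed.
Fact fps_mulD : left_distributive fps_mul fps_add.
Proof.
move=> f g h; apply: fpsP => n /=; rewrite -big_split.
by apply: eq_bigr => i _; rewrite mulrDl.
Qed.
Fact fps_one_neq0 : fps_one != 0 :> fps A.
Proof.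
apply/eqP => /(congr1 (fun f : fps A => f 0%N)) /= /eqP.
by rewrite oner_eq0.
Qed.

HB.instance Definition _ := GRing.Zmodule_isComNzRing.Build (fps A)
  fps_mulA fps_mulC fps_mul1 fps_mulD fps_one_neq0.

Lemma fcoefD f g n : (f + g) n = f n + g n. Proof. by []. Qed.
Lemma fcoefN f n : (- f) n = - f n. Proof. by []. Qed.
Lemma fcoefB f g n : (f - g) n = f n - g n. Proof. by []. Qed.
Lemma fcoef0 n : (0 : fps A) n = 0. Proof. by []. Qed.
Lemma fcoef1 n : (1 : fps A) n = (n == 0%N)%:R. Proof. by []. Qed.
Lemma fcoefM f g n : (f * g) n = \sum_(i < n.+1) f i * g (n - i)%N.
Proof. by []. Qed.
Lemma fcoefM0 f g : (f * g) 0%N = f 0%N * g 0%N.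
Proof. by rewrite fcoefM big_ord1. Qed.
Lemma fcoef_sum I (r : seq I) (P : pred I) (F : I -> fps A) n :
  (\sum_(i <- r | P i) F i) n = \sum_(i <- r | P i) F i n.
Proof. by elim/big_rec2: _ => // i x y _ <-. Qed.
Lemma fcoefMn f k n : (f *+ k) n = f n *+ k.
Proof. by elim: k => // k IH; rewrite !mulrS fcoefD IH. Qed.
Lemma fcoef_nat k n : (k%:R : fps A) n = k%:R *+ (n == 0%N).
Proof. by rewrite fcoefMn fcoef1; case: (n == 0%N); rewrite ?mulr1n // mulr0n mul0rn. Qed.

Definition fconst (a : A) : fps A := Fps (fun n => if n == 0%N then a else 0).

Lemma fcoefCM a f n : (fconst a * f) n = a * f n.
Proof.
by rewrite fcoefM big_ord_recl /= subn0 big1 ?addr0 // => i _; rewrite mul0r.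
Qed.

(** Here [u * f] is [1 - h] with [h] free of constant term, and the geometric series of [h] inverts
    it. In the bivariate case the ring [A] is itself a ring of series. *)
Lemma fps_exists_inv f (u : A) : u * f 0%N = 1 -> exists g, f * g = 1.
Proof.
move=> uf; pose h : fps A := 1 - fconst u * f.
have h0 : h 0%N = 0 by rewrite fcoefB fcoefCM uf fcoef1 subrr.
have hX k n : (n < k)%N -> (h ^+ k) n = 0.
  elim: k n => // k IH n le_nk; rewrite exprS fcoefM big1 // => i _.
  have [->|] := eqVneq (i : nat) 0%N; first by rewrite h0 mul0r.
  by move=> i_neq0; rewrite IH ?mulr0 //; have := ltn_ord i; lia.
pose S k : fps A := \sum_(i < k) h ^+ i.
have hS k : (1 - h) * S k = 1 - h ^+ k.
  elim: k => [|k IH]; first by rewrite /S big_ord0 mulr0 expr0 subrr.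
  rewrite /S big_ord_recr /= mulrDr IH exprS; ring.
(* Powers [h ^+ i] with [i > n] do not reach coefficient [n], so the infinite sum is read off along
   the diagonal of the partial sums. *)
pose g : fps A := Fps (fun n => S n.+1 n).
have gS k n : (n < k)%N -> S k n = g n.
  elim: k => // k IH; rewrite ltnS leq_eqVlt => /predU1P[-> //|lt_nk].
  by rewrite /S big_ord_recr fcoefD -/(S k) IH // hX // addr0.
have hg : (1 - h) * g = 1.
  apply: fpsP => n; transitivity (((1 - h) * S n.+1) n).
    rewrite !fcoefM; apply: eq_bigr => i _; rewrite gS //.
    by rewrite ltnS leq_subr.
  by rewrite hS fcoefB hX // subr0.
exists (fconst u * g); rewrite -hg /h; ring.
Qed.

Definition fderiv f : fps A := Fps (fun n => f n.+1 *+ n.+1).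

Lemma fderivD f g : fderiv (f + g) = fderiv f + fderiv g.
Proof. by apply: fpsP => n; rewrite /= mulrnDl. Qed.

Lemma trunc_fderiv n f : fps_trunc n (fderiv f) = (fps_trunc n.+1 f)^`().
Proof.
apply/polyP => i; rewrite coef_deriv !coef_poly ltnS.
by case: ltnP => // _; rewrite mul0rn.
Qed.

Lemma fderivM f g : fderiv (f * g) = fderiv f * g + f * fderiv g.
Proof.
apply: fpsP => n; have lt_n2 : (n.+1 < n.+2)%N by [].
rewrite /= -[\sum_(i < _) _]/(fps_mul f g n.+1) (coef_fps_mul f g lt_n2).
rewrite -coef_deriv derivM coefD -!trunc_fderiv.
have lt_n1 : (n < n.+1)%N by [].
rewrite -[\sum_(i < n.+1) f i * _]/(fps_mul f (fderiv g) n).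
rewrite -[\sum_(i < n.+1) _]/(fps_mul (fderiv f) g n) !(coef_fps_mul _ _ lt_n1).
congr (_ + _).
  apply: (coef_mul_trunc (n := n.+1)) => // i lt_in.
  by rewrite !coef_poly lt_in ltnS ltnW.
apply: (coef_mul_trunc (n := n.+1)) => // i lt_in.
by rewrite !coef_poly lt_in ltnS ltnW.
Qed.

End FpsRing.

Lemma fconst0 (A : comNzRingType) : fconst 0 = 0 :> fps A.
Proof. by apply: fpsP => n /=; case: eqP. Qed.

Lemma fconstM (A : comNzRingType) (a b : A) : fconst (a * b) = fconst a * fconst b.
Proof. by apply: fpsP => n; rewrite fcoefCM /=; case: eqP; rewrite ?mulr0. Qed.

Lemma fconst1 (A : comNzRingType) : fconst 1 = 1 :> fps A.
Proof. by apply: fpsP => n /=; case: eqP. Qed.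

Lemma fderiv_const (A : comNzRingType) (a : A) : fderiv (fconst a) = 0.
Proof. by apply: fpsP => n; rewrite /= mul0rn. Qed.

Lemma fconstN (A : comNzRingType) (a : A) : fconst (- a) = - fconst a.
Proof. by apply: fpsP => n; rewrite /=; case: eqP => //; rewrite oppr0. Qed.

Definition fmap_coef (A B : Type) (d : A -> B) (f : fps A) : fps B :=
  Fps (fun n => d (f n)).

Definition is_derivation (A : comNzRingType) (d : A -> A) :=
  (forall f g, d (f + g) = d f + d g) /\
  (forall f g, d (f * g) = d f * g + f * d g).

Section Derivation.
Variables (A : comNzRingType) (d : A -> A).
Hypothesis dP : is_derivation d.
Lemma derivationD f g : d (f + g) = d f + d g. Proof. by case: dP. Qed.
Lemma derivationM f g : d (f * g) = d f * g + f * d g. Proof. by case: dP. Qed.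
Lemma derivation0 : d 0 = 0.
Proof. by apply: (addIr (d 0)); rewrite -derivationD !add0r. Qed.
Lemma derivationN f : d (- f) = - d f.
Proof. by apply/eqP; rewrite eq_sym -subr_eq0 -opprD -derivationD subrr derivation0 oppr0. Qed.
Lemma derivationB f g : d (f - g) = d f - d g.
Proof. by rewrite derivationD derivationN. Qed.
Lemma derivation1 : d 1 = 0.
Proof.
have /eqP := derivationM 1 1; rewrite !mulr1 mul1r -[X in X == _]addr0.
by rewrite (inj_eq (addrI _)) eq_sym => /eqP.
Qed.
Lemma derivationMn f n : d (f *+ n) = d f *+ n.
Proof. by elim: n => [|n IH]; rewrite ?derivation0 // !mulrS derivationD IH. Qed.
End Derivation.

Lemma fderiv_derivation (A : comNzRingType) : is_derivation (@fderiv A).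
Proof. by split; [exact: fderivD | exact: fderivM]. Qed.

Lemma fmap_derivation (A : comNzRingType) (d : A -> A) :
  is_derivation d -> is_derivation (fmap_coef d).
Proof.
move=> dP; split=> f g; apply: fpsP => n /=; first exact: derivationD.
rewrite (big_morph d (derivationD dP) (derivation0 dP)) -big_split /=.
by apply: eq_bigr => i _; rewrite derivationM.
Qed.

(** * The generating function *)

Section ExcedanceSeries.
Variables (R : numFieldType) (L : R).

Definition fexp (a : R) : fps R := Fps (fun n => a ^+ n / n`!%:R).

Lemma fexp0E (a : R) : fexp a 0%N = 1.
Proof. by rewrite /= expr0 fact0 divr1. Qed.

Lemma fderiv_fexp (a : R) : fderiv (fexp a) = fconst a * fexp a.
Proof.
apply: fpsP => n; rewrite fcoefCM /= factS exprS natrM -mulr_natr.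
have := fact_gt0 n; rewrite -(ltr_nat R) => /lt0r_neq0 ?.
by field; rewrite ?mulrS; apply/andP; split => //; rewrite -mulrS pnatr_eq0.
Qed.

(* Bivariate series: the outer variable is delta, the inner one sigma. *)
Notation bfps := (fps (fps R)).

Definition dsig : bfps -> bfps := fmap_coef (@fderiv R).
Definition ddel : bfps -> bfps := @fderiv (fps R).
Definition ev (f : bfps) : R := f 0%N 0%N.

Definition cst (a : R) : bfps := fconst (fconst a).
(** In closed form [exps] is e^(L sigma) and [expd a] is e^(a delta). *)
Definition exps : bfps := fconst (fexp L).
Definition expd (a : R) : bfps := Fps (fun n => fconst (fexp a n)).

Lemma dsig_derivation : is_derivation dsig.
Proof. exact/fmap_derivation/fderiv_derivation. Qed.
Lemma ddel_derivation : is_derivation ddel.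
Proof. exact: fderiv_derivation. Qed.

Lemma ddel_dsig f : ddel (dsig f) = dsig (ddel f).
Proof.
by apply: fpsP => n; rewrite /= (derivationMn (fderiv_derivation R)).
Qed.

Lemma dsig_cst a : dsig (cst a) = 0.
Proof.
apply: fpsP => n /=; case: eqP => _; first exact: fderiv_const.
by apply: fpsP => k /=; rewrite mul0rn.
Qed.

Lemma dsig_exps : dsig exps = cst L * exps.
Proof.
apply: fpsP => n; rewrite fcoefCM /=; case: eqP => _; first exact: fderiv_fexp.
by rewrite mulr0; apply: fpsP => k /=; rewrite mul0rn.
Qed.

Lemma ddel_exps : ddel exps = 0. Proof. exact: fderiv_const. Qed.

Lemma dsig_expd a : dsig (expd a) = 0.
Proof. by apply: fpsP => n; exact: fderiv_const. Qed.

Lemma ddel_expd a : ddel (expd a) = cst a * expd a.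
Proof.
apply: fpsP => n; rewrite fcoefCM; apply: fpsP => k.
rewrite fcoefCM [RHS]/= -[LHS]/((fconst (fexp a n.+1) *+ n.+1) k) fcoefMn /=.
have /(congr1 (fun f : fps R => f n)) := fderiv_fexp a.
rewrite fcoefCM /= => E; case: eqP => _ //; by rewrite ?mul0rn ?mulr0.
Qed.

(** The product has zero derivative in delta and constant coefficient 1, which determines it in
    characteristic 0. *)
Lemma expdN a : expd a * expd (- a) = 1.
Proof.
have d0 : ddel (expd a * expd (- a)) = 0.
  rewrite (derivationM ddel_derivation) !ddel_expd.
  have -> : cst (- a) = - cst a.
    apply: fpsP => n; apply: fpsP => k /=; case: eqP => _ /=; last by rewrite oppr0.
    by case: eqP => _ //=; rewrite oppr0.
  ring.
apply: fpsP => -[|n].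
  rewrite fcoefM0 /= -fconstM !expr0 fact0 !divr1 mulr1 fconst1; exact: erefl.
apply: fpsP => k; have := congr1 (fun f : bfps => f n k) d0.
rewrite /= -[X in X = _]/((((expd a * expd (- a)) n.+1) *+ n.+1) k) fcoefMn.
by move=> /eqP; rewrite mulrn_eq0 /= => /eqP.
Qed.

(* With [x = sigma + delta] and [y = sigma - delta] these are [2 d/dx] and
   [2 d/dy]. *)
Definition dplus (f : bfps) : bfps := dsig f + ddel f.
Definition dminus (f : bfps) : bfps := dsig f - ddel f.

Lemma dplus_derivation : is_derivation dplus.
Proof.
rewrite /dplus; split=> f g.
  by rewrite (derivationD dsig_derivation) (derivationD ddel_derivation) addrACA.
rewrite (derivationM dsig_derivation) (derivationM ddel_derivation); ring.
Qed.

Lemma dminus_derivation : is_derivation dminus.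
Proof.
rewrite /dminus; split=> f g.
  rewrite (derivationD dsig_derivation) (derivationD ddel_derivation); ring.
rewrite (derivationM dsig_derivation) (derivationM ddel_derivation); ring.
Qed.

Lemma ddel_cst a : ddel (cst a) = 0. Proof. exact: fderiv_const. Qed.
Lemma dplus_cst a : dplus (cst a) = 0.
Proof. by rewrite /dplus dsig_cst ddel_cst addr0. Qed.
Lemma dminus_cst a : dminus (cst a) = 0.
Proof. by rewrite /dminus dsig_cst ddel_cst subr0. Qed.

Lemma cstM a b : cst (a * b) = cst a * cst b.
Proof. by rewrite /cst !fconstM. Qed.
Lemma cstN a : cst (- a) = - cst a.
Proof.
apply: fpsP => n; apply: fpsP => k /=; case: eqP => _ /=; last by rewrite oppr0.
by case: eqP => _ //=; rewrite oppr0.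
Qed.
Lemma cst_nat n : cst n%:R = n%:R.
Proof.
apply: fpsP => i; apply: fpsP => k.
rewrite fcoef_nat fcoefMn fcoef_nat /=.
by case: eqP => _ /=; [case: eqP | rewrite mulr0n].
Qed.
Lemma cst1 : cst 1 = 1. Proof. exact: cst_nat 1%N. Qed.

Lemma evD f g : ev (f + g) = ev f + ev g. Proof. by []. Qed.
Lemma evN f : ev (- f) = - ev f. Proof. by []. Qed.
Lemma evM f g : ev (f * g) = ev f * ev g.
Proof. by rewrite /ev !fcoefM0. Qed.
Lemma ev_cst a : ev (cst a) = a. Proof. by []. Qed.

Section LogDerivative.
Variables (A : comNzRingType) (d : A -> A).
Hypothesis dP : is_derivation d.

(** An equation [d f = f * a] says, without division, that [a] is the logarithmic derivative of
    [f]. *)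
Lemma logderivM f g a b : d f = f * a -> d g = g * b ->
  d (f * g) = f * g * (a + b).
Proof. by move=> df dg; rewrite (derivationM dP) df dg; ring. Qed.

Lemma logderivX f a n : d f = f * a -> d (f ^+ n) = f ^+ n * (n%:R * a).
Proof.
move=> df; elim: n => [|n IH]; first by rewrite expr0 (derivation1 dP) mul0r mulr0.
by rewrite exprS (logderivM df IH) -natr1; ring.
Qed.

Lemma derivation_inv D f : D * f = 1 -> d f = - (f ^+ 2 * d D).
Proof.
move=> Df; have := derivationM dP D f; rewrite Df (derivation1 dP) => E.
have -> : d f = f * (d D * f + D * d f) - f ^+ 2 * d D + (1 - D * f) * d f.
  by ring.
by rewrite -E Df; ring.
Qed.
End LogDerivative.

(** This is 2 cosh v - e^u with u = L sigma and v = L delta. *)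
Definition exc_den : bfps := expd L + expd (- L) - exps.

(** * Differential equations of the generating function *)

Section Phi.
Variable phi : bfps.
Hypothesis phiP : exc_den * phi = 1.

Let E := expd L.
Let E' := expd (- L).
Let s := exps.
Let h := E' * phi.
Let w := s * E - 1.
Let ell := cst L.

Lemma dplus_phi : dplus phi = phi * (ell * (2%:R * h - 1)).
Proof.
rewrite (derivation_inv dplus_derivation phiP) /exc_den.
rewrite (derivationB dplus_derivation) (derivationD dplus_derivation).
rewrite /dplus !dsig_expd !ddel_expd dsig_exps ddel_exps cstN.
transitivity (phi * (ell * (2%:R * h - exc_den * phi))); last by rewrite phiP.
by rewrite /h /exc_den /ell /E'; ring.
Qed.

Lemma dplus_h : dplus h = h * (ell * (2%:R * h - 2%:R)).
Proof.
have dE : dplus E' = E' * - ell.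
  by rewrite /dplus dsig_expd ddel_expd cstN -/ell -/E'; ring.
by rewrite (logderivM dplus_derivation dE dplus_phi); rewrite -/h; ring.
Qed.

(* [i.+1`! * excV i] is the exponential generating function of
   [bras_count i r s], with [x] and [y] rescaled by [L]. *)
Definition excV i : bfps := phi ^+ 2 * h ^+ i.

(** After multiplication by (i+1)! this is the recursion [bras_countS], solved for the count with
    one more excedance. *)
Lemma dplus_excV i :
  dplus (excV i)
  = cst (2 * L * i.+2%:R) * excV i.+1 - cst (2 * L * i.+1%:R) * excV i.
Proof.
rewrite /excV; have P := dplus_derivation.
rewrite (logderivM P (logderivX P 2 dplus_phi) (logderivX P i dplus_h)).
rewrite !cstM -/ell !cst_nat (exprS h) -(natr1 i.+1) -(natr1 i); ring.
Qed.

Lemma ev_w : ev w = 0.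
Proof.
rewrite evD evM evN -cst1 ev_cst /s /E /ev /= !expr0 fact0 !divr1 mul1r.
by rewrite subrr.
Qed.

(** [w] is e^(L x) - 1, which does not involve y. *)
Lemma dminus_w : dminus w = 0.
Proof.
rewrite (derivationB dminus_derivation) (derivation1 dminus_derivation).
rewrite (derivationM dminus_derivation) /dminus !dsig_expd !ddel_expd.
rewrite dsig_exps ddel_exps /s /E; ring.
Qed.

(** [E] exceeds [exc_den] by [s - E'], which is [E' * w] because [E * E' = 1]. *)
Lemma phi_w : E * phi = 1 + w * h.
Proof.
have EE : E * E' = 1 by exact: expdN.
transitivity (exc_den * phi + (s * (E * E') - E') * phi).
  by rewrite EE /exc_den -/E -/E' -/s; ring.
by rewrite phiP /w /h; ring.
Qed.

Lemma dminus_phi : dminus phi = phi * (ell * (1 + 2%:R * (w * h))).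
Proof.
rewrite (derivation_inv dminus_derivation phiP) /exc_den.
rewrite (derivationB dminus_derivation) (derivationD dminus_derivation).
rewrite /dminus !dsig_expd !ddel_expd dsig_exps ddel_exps cstN.
transitivity (phi * (ell * (2%:R * (E * phi) - exc_den * phi))); last first.
  by rewrite phiP phi_w; ring.
by rewrite /exc_den /ell /E; ring.
Qed.

Lemma dminus_h : dminus h = h * (ell * (2%:R + 2%:R * (w * h))).
Proof.
have dE : dminus E' = E' * ell.
  by rewrite /dminus dsig_expd ddel_expd cstN -/ell -/E'; ring.
by rewrite (logderivM dminus_derivation dE dminus_phi); rewrite -/h; ring.
Qed.

(** At x = 0, where [w] vanishes, this is the recursion [bras_count0S] for words without the letter
    b. *)
Lemma dminus_excV i :
  exists q, dminus (excV i) = cst (2 * L * i.+1%:R) * excV i + w * q.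
Proof.
exists (excV i * (ell * (2%:R * i.+2%:R * h))).
rewrite /excV; have P := dminus_derivation.
rewrite (logderivM P (logderivX P 2 dminus_phi) (logderivX P i dminus_h)).
rewrite !cstM -/ell !cst_nat -(natr1 i.+1) -(natr1 i); ring.
Qed.

(* The ideal generated by [w], that is by [e ^ Lx - 1], is stable under [d/dy]
   and vanishes at the origin. *)
Lemma ev_iter_dminus c f q n : dminus f = cst c * f + w * q ->
  ev (iter n dminus f) = c ^+ n * ev f.
Proof.
move=> df; suff [q' ->] : exists q', iter n dminus f = cst (c ^+ n) * f + w * q'.
  by rewrite evD !evM ev_w mul0r addr0 ev_cst.
have P := dminus_derivation.
elim: n => [|n [q' IH]]; first by exists 0; rewrite expr0 cst1 /=; ring.
exists (cst (c ^+ n) * q + dminus q'); rewrite iterS IH (derivationD P).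
rewrite !(derivationM P) dminus_w dminus_cst df exprS cstM; ring.
Qed.

Lemma ev_excV i : ev (excV i) = 1.
Proof.
have evphi : ev phi = 1.
  have := congr1 ev phiP; rewrite evM -cst1 ev_cst /exc_den !evD evN.
  by rewrite /ev /= !expr0 fact0 !divr1 addrK mul1r.
have evh : ev h = 1 by rewrite evM evphi mulr1 /ev /= expr0 fact0 divr1.
have evX f n : ev f = 1 -> ev (f ^+ n) = 1.
  move=> evf; elim: n => [|n IH]; first by rewrite expr0 -cst1.
  by rewrite exprS evM evf IH mulr1.
by rewrite /excV evM !evX // mulr1.
Qed.

Lemma iter_derivation_lin d a b f g n : is_derivation d ->
  (forall c, d (cst c) = 0) ->
  iter n d (cst a * f - cst b * g) = cst a * iter n d f - cst b * iter n d g.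
Proof.
move=> P dc; elim: n => //= n ->.
rewrite (derivationB P) !(derivationM P) !dc; ring.
Qed.

(** Induction on [r] for all [i] at once: words without b are settled by [dminus_excV], and each
    further b matches [dplus_excV] with [bras_countS]. Every derivation contributes a factor 2 L by
    the choice of scale. *)
Lemma ev_iter_excV r e i :
  ev (iter e dminus (iter r dplus (excV i))) * i.+1`!%:R
  = (2 * L) ^+ (r + e) * (bras_count i r e)%:R.
Proof.
elim: r i => [|r IH] i.
  have [q dq] := dminus_excV i; rewrite /= (ev_iter_dminus e dq) ev_excV mulr1.
  rewrite add0n exprMn -mulrA; congr (_ * _).
  elim: e => [|e IHe]; first by rewrite bras_count00 expr0 mul1r.
  by rewrite bras_count0S natrM -IHe exprS mulrA.
rewrite iterSr dplus_excV (iter_derivation_lin _ _ _ _ _ dplus_derivation dplus_cst).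
rewrite (iter_derivation_lin _ _ _ _ _ dminus_derivation dminus_cst).
rewrite evD evN !evM !ev_cst addSn exprS.
have IHi := IH i; have := IH i.+1; rewrite bras_countS natrD natrM factS natrM => IHi1.
set x := ev _ in IHi1 *; set y := ev _ in IHi *.
have -> : (2 * L * i.+2%:R * x - 2 * L * i.+1%:R * y) * i.+1`!%:R =
  2 * L * (x * (i.+2%:R * i.+1`!%:R) - i.+1%:R * (y * i.+1`!%:R)) by ring.
rewrite IHi IHi1; ring.
Qed.

End Phi.
End ExcedanceSeries.

(** * Mixed derivatives at the origin in the variables sigma and delta *)

Section CrossDerivatives.
Variables (R : numFieldType) (L : R).
Notation bfps := (fps (fps R)).
Implicit Types f g : bfps.

Definition dsq f : bfps := dsig (dsig f) - ddel (ddel f).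

Lemma dminus_dplus f : dminus (dplus f) = dsq f.
Proof.
rewrite /dminus /dplus (derivationD (dsig_derivation R)).
by rewrite (derivationD (ddel_derivation R)) ddel_dsig /dsq; ring.
Qed.

Lemma dplus_dminus f : dplus (dminus f) = dminus (dplus f).
Proof.
rewrite dminus_dplus /dminus /dplus (derivationB (dsig_derivation R)).
by rewrite (derivationB (ddel_derivation R)) ddel_dsig /dsq; ring.
Qed.

(** The two derivations commute, so each [dplus] pairs with one [dminus] into [dsq], and [e] of the
    latter remain. *)
Lemma iter_dminus_dplus e r f :
  iter (r + e) (@dminus R) (iter r (@dplus R) f) = iter e (@dminus R) (iter r dsq f).
Proof.
elim: r f => // r IH f.
rewrite addSn iterSr [iter r.+1 (@dplus R) f]iterSr.
have <- : forall g, iter r (@dplus R) (dminus g) = dminus (iter r (@dplus R) g).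
  by elim: r {IH} => // r IH g; rewrite !iterS IH dplus_dminus.
by rewrite IH dminus_dplus iterSr.
Qed.

(** The derivative at the origin of order [i] in sigma and [l] in delta; delta is the outer
    variable, hence the swapped indices. *)
Definition taylor f i l : R := f l i *+ (i`! * l`!).

Lemma taylorB f g i l : taylor (f - g) i l = taylor f i l - taylor g i l.
Proof. by rewrite /taylor -mulrnBl. Qed.
Lemma taylor_dsig f i l : taylor (dsig f) i l = taylor f i.+1 l.
Proof. by rewrite /taylor /= -mulrnA factS mulnA. Qed.
Lemma taylor_ddel f i l : taylor (ddel f) i l = taylor f i l.+1.
Proof. by rewrite /taylor /= fcoefMn -mulrnA factS mulnCA. Qed.
Lemma taylor_dsq f i l : taylor (dsq f) i l = taylor f i.+2 l - taylor f i l.+2.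
Proof. by rewrite taylorB !taylor_dsig !taylor_ddel. Qed.

(** One more factor X - Y in the binomial expansion of (X - Y)^n, by Pascal's rule. *)
Lemma binomial_diff_sum (y : nat -> nat -> R) n :
  \sum_(j < n.+1) 'C(n, j)%:R * (-1) ^+ j * (y (n - j).+1 j - y (n - j)%N j.+1)
  = \sum_(j < n.+2) 'C(n.+1, j)%:R * (-1) ^+ j * y (n.+1 - j)%N j.
Proof.
rewrite [RHS]big_ord_recl /= bin0.
under [X in _ = _ + X]eq_bigr => j _.
  rewrite /bump /= add1n binS natrD exprS subSS.
  rewrite mulrDl mulrDl.
  over.
rewrite big_split /= addrA.
rewrite (eq_bigr (fun j : 'I_n.+1 => 'C(n, j)%:R * (-1) ^+ j * y (n - j).+1 j
   + 'C(n, j)%:R * (-1 * (-1) ^+ j) * y (n - j)%N j.+1)); last by move=> j _; ring.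
rewrite big_split /=; congr (_ + _).
rewrite big_ord_recl /= bin0 [in RHS]big_ord_recr /= bin_small // !mul0r addr0.
congr (_ + _); first by rewrite subn0.
apply: eq_bigr => j _; rewrite /bump /= add1n exprS.
by congr (_ * y _ _); have := ltn_ord j; lia.
Qed.

Lemma taylor_iter_dsq f r i l :
  taylor (iter r dsq f) i l
  = \sum_(j < r.+1) 'C(r, j)%:R * (-1) ^+ j * taylor f (i + (r - j).*2)%N (l + j.*2)%N.
Proof.
elim: r f => [|r IH] f; first by rewrite big_ord1 /= !addn0 bin0 expr0 !mul1r.
rewrite iterSr IH -(binomial_diff_sum (fun p q => taylor f (i + p.*2) (l + q.*2))).
by apply: eq_bigr => j _; rewrite taylor_dsq !doubleS !addnS.
Qed.

(** If one [dminus] is left over, its [ddel] half yields only odd orders in delta, which vanish as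
    [f] is even in delta; its [dsig] half raises the order in sigma by one. *)
Lemma ev_cross_derivative f r e : (e <= 1)%N -> (forall l, f l.*2.+1 = 0) ->
  ev (iter (r + e) (@dminus R) (iter r (@dplus R) f))
  = \sum_(j < r.+1) 'C(r, j)%:R * (-1) ^+ j
      * (f j.*2 (r + (r + e) - j.*2)%N *+ ((r + (r + e) - j.*2)`! * j.*2`!)).
Proof.
move=> e1 fodd; rewrite iter_dminus_dplus.
have -> : ev (iter e (@dminus R) (iter r dsq f)) = taylor (iter r dsq f) e 0.
  case: e e1 => [|[|//]] _ /=; first by rewrite /taylor mulr1n.
  rewrite -[LHS]mulr1n -[LHS]/(taylor _ 0 0) /dminus taylorB taylor_dsig taylor_ddel.
  rewrite [X in _ - X]taylor_iter_dsq [X in _ - X]big1 ?subr0 // => j _.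
  by rewrite /taylor add1n fodd mul0rn mulr0.
rewrite taylor_iter_dsq; apply: eq_bigr => j _; rewrite /taylor add0n.
have -> // : (e + (r - j).*2 = r + (r + e) - j.*2)%N.
by have := ltn_ord j; lia.
Qed.

Lemma exc_den_odd l : exc_den L l.*2.+1 = 0.
Proof.
apply: fpsP => k; rewrite /exc_den /= subr0; case: eqP => _; last by rewrite addr0.
by rewrite -mulrDl exprNn -signr_odd /= odd_double expr1 mulN1r subrr mul0r.
Qed.

Lemma exc_den_even l : exc_den L l.*2.+2 = fconst (2 * L ^+ l.*2.+2 / l.*2.+2`!%:R).
Proof.
apply: fpsP => k; rewrite /exc_den /= subr0; case: eqP => _; last by rewrite addr0.
by rewrite -mulrDl exprNn -signr_odd /= odd_double expr0 mul1r -mulr2n mulr_natl.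
Qed.

Lemma exc_den_0 : exc_den L 0%N = 2%:R - fexp L.
Proof.
apply: fpsP => k; rewrite [RHS]fcoefB fcoef_nat /exc_den /=.
rewrite !expr0 fact0 !divr1.
by case: eqP => _; rewrite ?mulr1n ?mulr0n ?addr0.
Qed.

Section Coefficients.
Variable phi : bfps.
Hypothesis phiP : exc_den L * phi = 1.

(** The inverse of an even series is even: by induction, an odd coefficient of [exc_den L * phi]
    reduces to the term with [exc_den L 0], which is invertible. *)
Lemma phi_odd l : phi l.*2.+1 = 0.
Proof.
have [n] := ubnP l; elim: n l => // n IH l le_ln.
have psiP : phi 0%N * exc_den L 0%N = 1.
  by have := congr1 (fun f : bfps => f 0%N) phiP; rewrite fcoefM0 mulrC.
have E : (exc_den L * phi) l.*2.+1 = 0 by rewrite phiP fcoef1.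
rewrite fcoefM big_ord_recl subn0 big1 ?addr0 in E; last first.
  move=> i _; rewrite lift0.
  have [m [-> |Ei]] : exists m, (i : nat) = m.*2 \/ (i : nat) = m.*2.+1.
    by exists (i./2); have := odd_double_half i; case: (odd i) => /= E; [right|left]; lia.
    by rewrite exc_den_odd mul0r.
  have -> : (l.*2.+1 - i.+1 = (l - m.+1).*2.+1)%N by have := ltn_ord i; lia.
  by rewrite IH ?mulr0 //; have := ltn_ord i; lia.
by rewrite -[LHS]mul1r -psiP -mulrA E mulr0.
Qed.

Lemma phi2_odd l : (phi ^+ 2) l.*2.+1 = 0.
Proof.
rewrite expr2 fcoefM big1 // => i _.
have [m [-> |Ei]] : exists m, (i : nat) = m.*2.+1 \/ (i : nat) = m.*2.
  by exists (i./2); have := odd_double_half i; case: (odd i) => /= E; [left|right]; lia.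
  by rewrite phi_odd mul0r.
have -> : (l.*2.+1 - i = (l - m).*2.+1)%N by have := ltn_ord i; lia.
by rewrite phi_odd mulr0.
Qed.

(** The same mixed derivative of [phi ^+ 2], which is [excV] at index 0, is computed in both
    coordinate systems. *)
Lemma bras_count_fps r e : (e <= 1)%N ->
  (2 * L) ^+ (r + (r + e)) * (bras_count 0 r (r + e))%:R
  = \sum_(j < r.+1) 'C(r, j)%:R * (-1) ^+ j
      * ((phi ^+ 2) j.*2 (r + (r + e) - j.*2)%N
         *+ ((r + (r + e) - j.*2)`! * j.*2`!)).
Proof.
move=> e1; rewrite -(ev_iter_excV phiP) mulr1 /excV expr0 mulr1.
exact: ev_cross_derivative e1 phi2_odd.
Qed.

End Coefficients.
End CrossDerivatives.

(** * Coefficient bounds *)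

Section CoefOrder.
Variable R : realFieldType.
Implicit Types f g h : fps R.

Definition fps_le f g := forall n, f n <= g n.

Lemma fps_le_refl f : fps_le f f. Proof. by move=> n. Qed.
Lemma fps_le_trans g f h : fps_le f g -> fps_le g h -> fps_le f h.
Proof. by move=> fg gh n; apply: le_trans (fg n) (gh n). Qed.
Lemma fps_ge0_mul f g : fps_le 0 f -> fps_le 0 g -> fps_le 0 (f * g).
Proof.
by move=> f0 g0 n; rewrite fcoefM sumr_ge0 // => i _; rewrite mulr_ge0 ?f0 ?g0.
Qed.
Lemma fps_le_mul2l f g h : fps_le 0 f -> fps_le g h -> fps_le (f * g) (f * h).
Proof.
move=> f0 gh n; rewrite !fcoefM ler_sum // => i _.
by rewrite ler_wpM2l ?gh // f0.
Qed.
Lemma fps_le_mul2r f g h : fps_le 0 f -> fps_le g h -> fps_le (g * f) (h * f).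
Proof. by move=> f0 gh; rewrite ![_ * f]mulrC; apply: fps_le_mul2l. Qed.
Lemma fps_ge0_1 : fps_le 0 (1 : fps R).
Proof. by move=> n; rewrite fcoef1; case: eqP. Qed.
Lemma fps_ge0_exp f n : fps_le 0 f -> fps_le 0 (f ^+ n).
Proof.
move=> f0; elim: n => [|n IH]; first by rewrite expr0; exact: fps_ge0_1.
by rewrite exprS; apply: fps_ge0_mul.
Qed.

(** Start from [f * g >= f * q - d f * q'], then use the lower bound of [f] in the first product and
    its upper bound in the second. *)
Lemma fps_le_mul_lower f g p p' q q' c d : 0 <= d ->
  fps_le 0 f -> fps_le 0 q -> fps_le 0 q' -> fps_le f p ->
  fps_le (p - fconst c * p') f -> fps_le (q - fconst d * q') g ->
  forall n, (p * q) n - (c * (p' * q) n + d * (p * q') n) <= (f * g) n.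
Proof.
move=> d0 f0 q0 q'0 fp pf qg n.
have := fps_le_mul2l f0 qg n; have := fps_le_mul2r q0 pf n; have := fps_le_mul2r q'0 fp n.
rewrite mulrBr mulrBl mulrCA -[fconst c * p' * q]mulrA.
rewrite !fcoefB !fcoefCM => h1 h2 h3.
have := ler_wpM2l d0 h1; lra.
Qed.

Lemma alternating_sum_bound (y : nat -> R) n :
  (forall t, 0 <= y t) -> (forall t, y t.+1 <= y t) ->
  0 <= \sum_(t < n) (-1) ^+ t * y t <= y 0%N.
Proof.
elim: n y => [|n IH] y y0 yS; first by rewrite big_ord0 lexx y0.
have /andP[lo hi] := IH (fun t => y t.+1) (fun t => y0 _) (fun t => yS _).
rewrite big_ord_recl expr0 mul1r.
under eq_bigr => t _ do rewrite lift0 exprS mulN1r mulNr.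
rewrite sumrN; have := yS 0%N; lra.
Qed.

Lemma alternating_sum_ge (y : nat -> R) n :
  (forall t, 0 <= y t) -> (forall t, y t.+1 <= y t) ->
  y 0%N - y 1%N <= \sum_(t < n.+1) (-1) ^+ t * y t.
Proof.
move=> y0 yS; rewrite big_ord_recl expr0 mul1r.
under eq_bigr => t _ do rewrite lift0 exprS mulN1r mulNr.
have := alternating_sum_bound n (fun t => y0 t.+1) (fun t => yS t.+1).
rewrite sumrN; lra.
Qed.
End CoefOrder.

(** * A recursion with alternating signs *)

Section AlternatingRenewal.
Variable R : realFieldType.

(* [2 - 2 cos delta] is the sum of the [(-1) ^ t * cos_coef t * delta ^ (2t+2)]. *)
Definition cos_coef t : R := 2 / t.*2.+2`!%:R.

(** The quotient of consecutive coefficients is 1 / ((2t+4)(2t+3)), largest at t = 0. *)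
Lemma cos_coefS t : 0 <= cos_coef t.+1 <= cos_coef t / 12.
Proof.
rewrite /cos_coef doubleS (factS t.*2.+3) natrM (factS t.*2.+2) natrM.
set F : R := (t.*2.+2)`!%:R; have F0 : 0 < F by rewrite ltr0n fact_gt0.
set a : R := t.*2.+4%:R; set b : R := t.*2.+3%:R.
have ab : 12 <= a * b by rewrite -natrM ler_nat; lia.
have -> : 2 / (a * (b * F)) = 2 / F / (a * b).
  by rewrite -mulrA -invfM; congr (_ / _); ring.
have ab0 : 0 < a * b by apply: lt_le_trans ab.
have F2 : 0 <= 2 / F by rewrite divr_ge0 // ltW.
rewrite divr_ge0 ?(ltW ab0) //=.
by rewrite ler_wpM2l // lef_pV2 ?posrE.
Qed.

Lemma cos_coef_ge0 t : 0 <= cos_coef t.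
Proof. by rewrite /cos_coef divr_ge0 ?ler0n. Qed.

Variables (psi : fps R) (p : nat -> fps R).
Hypotheses (psi_ge0 : fps_le 0 psi) (psi0 : psi 0%N = 1) (p0 : p 0%N = psi).
(** With P the series of the [p l] in delta^2, this is P = psi (1 + (2 - 2 cos delta) P), which
    characterizes 1 / (1/psi - 2 + 2 cos delta). *)
Hypothesis pS : forall l,
  p l.+1 = psi * \sum_(t < l.+1) fconst ((-1) ^+ t * cos_coef t) * p (l - t)%N.

Lemma fps_le_mul_psi f : fps_le 0 f -> fps_le f (psi * f).
Proof.
move=> f0 n; rewrite fcoefM big_ord_recl psi0 mul1r subn0 lerDl sumr_ge0 // => i _.
by rewrite mulr_ge0 ?psi_ge0 ?f0.
Qed.

(** The predecessor of [p 0] counts as zero. *)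
Let pprev l : fps R := if l is l'.+1 then p l' else 0.

(** The second claim drives the induction: as [p] shrinks at most by a factor 3 per step and
    [cos_coef] shrinks at least by a factor 12, the terms of the recursion decrease and the
    alternating sum lies between its first one and first two terms. *)
Lemma alternating_renewal_step l :
  [/\ fps_le 0 (p l), fps_le (pprev l) (fconst 3 * p l),
      fps_le (p l.+1) (psi * p l)
    & fps_le (psi * (p l - fconst 12^-1 * pprev l)) (p l.+1) ].
Proof.
elim/ltn_ind: l => l IH.
have [pl_ge0 pprev_le] : fps_le 0 (p l) /\ fps_le (pprev l) (fconst 3 * p l).
  case: l IH => [|l] IH.
    rewrite p0 /=; split; first exact: psi_ge0.
    by move=> n; rewrite fcoefCM mulr_ge0 ?psi_ge0.
  have [pl0 ppl _ plS] := IH l (ltnSn l).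
  (* The constant is 1 - 3/12; it gives back the factor 3 with room to spare, since 4/3 <= 3. *)
  have lo : fps_le (fconst (3 / 4) * p l) (p l.+1).
    apply: fps_le_trans plS; apply: (fps_le_trans (g := psi * (fconst (3 / 4) * p l))).
      by apply: fps_le_mul_psi => n; rewrite fcoefCM mulr_ge0 ?pl0 // divr_ge0.
    apply: fps_le_mul2l psi_ge0 _ => n; rewrite fcoefB !fcoefCM.
    by have := ppl n; rewrite fcoefCM; lra.
  split=> n; have := lo n; have := pl0 n; rewrite !fcoefCM fcoef0 /=; lra.
(* The terms are extended by zero beyond [l], so that they decrease over all of [nat]. *)
pose y n t := cos_coef t * (if (t <= l)%N then p (l - t)%N n else 0).
have y0 n t : 0 <= y n t.
  rewrite mulr_ge0 ?cos_coef_ge0 //; case: leqP => // le_tl.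
  case: t le_tl => [|t] le_tl; first by rewrite subn0; exact: pl_ge0.
  by have [|/(_ n)] := IH (l - t.+1)%N; first by lia.
have yS n t : y n t.+1 <= y n t.
  rewrite {1}/y; case: (ltnP t l) => [lt_tl|le_lt]; last by rewrite mulr0.
  rewrite /y (ltnW lt_tl).
  have [q0 qS] : 0 <= p (l - t)%N n /\ p (l - t.+1)%N n <= 3 * p (l - t)%N n.
    have [E|/eqP t0] := eqVneq t 0%N.
      rewrite E subn0 subn1; split; first exact: pl_ge0.
      have := pprev_le n; rewrite fcoefCM.
      by move: lt_tl; rewrite E; case: (l).
    have [|a b _ _] := IH (l - t)%N; first by lia.
    split; first exact: a.
    have := b n; rewrite fcoefCM.
    by have -> : (l - t = (l - t.+1).+1)%N by lia.
  have /andP[k0 k1] := cos_coefS t.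
  apply: (le_trans (ler_wpM2l k0 qS)).
  have := ler_wpM2r q0 k1; have := mulr_ge0 (cos_coef_ge0 t) q0.
  lra.
have sumE n : (\sum_(t < l.+1) fconst ((-1) ^+ t * cos_coef t) * p (l - t)%N) n
   = \sum_(t < l.+1) (-1) ^+ t * y n t.
  rewrite fcoef_sum; apply: eq_bigr => t _; rewrite fcoefCM /y.
  by rewrite leq_ord -mulrA.
have cos_coef0 : cos_coef 0 = 1 by rewrite /cos_coef (_ : _`! = 2)%N // divff ?pnatr_eq0.
split=> //; rewrite pS; apply: fps_le_mul2l psi_ge0 _ => n.
  rewrite sumE; have /andP[_] := alternating_sum_bound l.+1 (y0 n) (yS n).
  by rewrite {2}/y subn0 cos_coef0 mul1r.
rewrite sumE; apply: le_trans (alternating_sum_ge l (y0 n) (yS n)).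
rewrite fcoefB fcoefCM {1}/y subn0 cos_coef0 mul1r lerD2l lerN2 /y.
have -> : cos_coef 1 = 12^-1 by rewrite /cos_coef (_ : _`! = 24)%N //; lra.
rewrite ler_wpM2l ?invr_ge0 // /pprev; case: (l) => // k; by rewrite subn1.
Qed.

(** Iterating the upper estimate gives [psi ^+ l.+1]; in the lower one each step loses at most a
    twelfth of the upper bound for the predecessor, which adds up to [l%:R / 12]. *)
Lemma alternating_renewal_bounds l :
  [/\ fps_le 0 (p l), fps_le (p l) (psi ^+ l.+1)
    & fps_le (psi ^+ l.+1 - fconst (l%:R / 12) * psi ^+ l) (p l)].
Proof.
have p_le k : fps_le (p k) (psi ^+ k.+1).
  elim: k => [|k IH]; first by rewrite p0 expr1; exact: fps_le_refl.
  have [_ _ pSk _] := alternating_renewal_step k; apply: (fps_le_trans pSk).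
  by rewrite [in X in fps_le _ X]exprS; apply: fps_le_mul2l psi_ge0 IH.
split=> //; first by have [] := alternating_renewal_step l.
elim: l => [|l IH].
  by rewrite p0 expr1 mul0r fconst0 mul0r subr0; exact: fps_le_refl.
have [_ _ _] := alternating_renewal_step l; apply: fps_le_trans.
rewrite (exprS psi l.+1) {2}(exprS psi l) mulrCA -mulrBr.
apply: fps_le_mul2l psi_ge0 _ => n; rewrite !fcoefB !fcoefCM.
have := IH n; rewrite fcoefB fcoefCM -(natr1 l).
have : pprev l n <= (psi ^+ l) n.
  by case: (l) => [|l']; [exact: fps_ge0_1 | exact: p_le].
lra.
Qed.
End AlternatingRenewal.

(** * Bounds for the coefficients of the generating function in delta *)

Section CoefficientBounds.
Variables (R : realFieldType) (L : R).
Hypothesis L_gt0 : 0 < L.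
Variable phi : fps (fps R).
Hypothesis phiP : exc_den L * phi = 1.

Definition psi : fps R := phi 0%N.

Lemma psiP : (2%:R - fexp L) * psi = 1.
Proof. by rewrite -exc_den_0 -fcoefM0 phiP. Qed.

Lemma psi0 : psi 0%N = 1.
Proof.
have := congr1 (fun f : fps R => f 0%N) psiP.
rewrite fcoefM0 fcoef1 fcoefB fcoef_nat fexp0E mulr1n => E.
by rewrite -[LHS]mul1r -[RHS]E; congr (_ * _); lra.
Qed.

(** The equation psi = 1 + (e^(L sigma) - 1) psi gives each coefficient as a nonnegative combination
    of earlier ones. *)
Lemma psi_ge0 : fps_le 0 psi.
Proof.
move=> n; elim/ltn_ind: n => -[_|n IH]; first by rewrite psi0 ler01.
have := congr1 (fun f : fps R => f n.+1) psiP.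
rewrite mulrBl fcoefB mulr_natl fcoefMn fcoef1 fcoefM big_ord_recl subn0.
rewrite fexp0E mul1r => E.
have -> : psi n.+1 = \sum_(i < n.+1) fexp L (lift ord0 i) * psi (n.+1 - lift ord0 i)%N.
  by move: E; rewrite mulr2n /= => E; lra.
apply: sumr_ge0 => i _; rewrite lift0 mulr_ge0 ?IH //; last by rewrite subSS; lia.
by rewrite /= divr_ge0 ?exprn_ge0 ?ler0n // ltW.
Qed.

(* the coefficient of [delta ^ 2l] in [1 / (2 cos delta - e ^ (L sigma))],
   after rescaling [delta] by [L] *)
Definition pcoef l : fps R := fconst ((-1) ^+ l / L ^+ l.*2) * phi l.*2.

Lemma sum_even (V : nmodType) (F : nat -> V) n : (forall m, F m.*2.+1 = 0) ->
  \sum_(i < n.*2.+1) F i = \sum_(t < n.+1) F t.*2.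
Proof.
move=> F0; elim: n => [|n IH]; first by rewrite !big_ord1.
by rewrite doubleS 2!big_ord_recr /= IH F0 addr0 [RHS]big_ord_recr doubleS.
Qed.

Lemma pcoef_even l : phi l.*2 = fconst ((-1) ^+ l * L ^+ l.*2) * pcoef l.
Proof.
rewrite /pcoef mulrA -fconstM [X in fconst X](_ : _ = 1) ?fconst1 ?mul1r //.
rewrite mulrACA divff ?expf_neq0 ?gt_eqF // mulr1 -exprD addnn.
by rewrite -signr_odd odd_double.
Qed.

(** This is the coefficient of delta^(2l+2) in [exc_den L * phi = 1], multiplied by [psi]; the signs
    in the definition of [pcoef] turn cosh into cos. *)
Lemma pcoefS l : pcoef l.+1
  = psi * \sum_(t < l.+1) fconst ((-1) ^+ t * cos_coef R t) * pcoef (l - t).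
Proof.
have E : (exc_den L * phi) l.+1.*2 = 0 by rewrite phiP fcoef1.
rewrite fcoefM in E.
rewrite (@sum_even _ (fun i => exc_den L i * phi (l.+1.*2 - i)%N)) in E; last first.
  by move=> m; rewrite exc_den_odd mul0r.
rewrite big_ord_recl [(nat_of_ord ord0).*2](_ : _ = 0%N) // subn0 exc_den_0 in E.
have {}E : (2%:R - fexp L) * phi l.+1.*2 =
    - \sum_(t < l.+1) fconst (2 * L ^+ t.*2.+2 / t.*2.+2`!%:R) * phi (l - t).*2.
  move/eqP: E; rewrite addr_eq0 => /eqP ->; congr (- _); apply: eq_bigr => t _.
  rewrite lift0 doubleS exc_den_even; congr (_ * phi _).
  by rewrite -!doubleS -doubleB subSS.
rewrite {1}/pcoef -[phi l.+1.*2]mul1r -psiP mulrAC E mulrA mulrC.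
congr (_ * _); rewrite mulrN mulr_sumr -sumrN; apply: eq_bigr => t _.
rewrite pcoef_even 2!mulrA -2!fconstM -mulNr; congr (_ * _).
rewrite -fconstN; congr fconst; rewrite /cos_coef; have le_tl := leq_ord t.
have {1}-> : (l.+1 = (l - t) + t.+1)%N by lia.
have -> : (l.+1.*2 = t.*2.+2 + (l - t).*2)%N by lia.
have Lu : L ^+ t.*2.+2 != 0 by rewrite expf_neq0 ?gt_eqF.
have Lv : L ^+ (l - t).*2 != 0 by rewrite expf_neq0 ?gt_eqF.
have Fu : t.*2.+2`!%:R != 0 :> R by rewrite pnatr_eq0 -lt0n fact_gt0.
have S : (-1) ^+ (l - t) * (-1) ^+ (l - t) = 1 :> R.
  by rewrite -exprD addnn -signr_odd odd_double.
rewrite [L ^+ (_ + _)]exprD [(-1) ^+ (_ + _)]exprD [(-1) ^+ t.+1]exprS.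
set a := L ^+ t.*2.+2 in Lu *; set b := L ^+ _ in Lv *.
set c := (-1) ^+ (l - t) in S *; set F := _%:R in Fu *; set d := (-1) ^+ t.
transitivity (c * c * (d * (2 / F))); last by rewrite S mul1r.
by field; rewrite Lu Lv Fu.
Qed.

Lemma pcoef_square l n :
  (-1) ^+ l / L ^+ l.*2 * (phi ^+ 2) l.*2 n = \sum_(a < l.+1) (pcoef a * pcoef (l - a)) n.
Proof.
rewrite expr2 [(phi * phi) _]fcoefM.
rewrite (@sum_even _ (fun i => phi i * phi (l.*2 - i)%N)); last first.
  by move=> m; rewrite (phi_odd phiP) mul0r.
rewrite -fcoefCM mulr_sumr fcoef_sum; apply: eq_bigr => a _.
have le_al := leq_ord a; rewrite -doubleB; congr (fcoef _ n).
have -> : (-1) ^+ l / L ^+ l.*2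
    = ((-1) ^+ a / L ^+ a.*2) * ((-1) ^+ (l - a) / L ^+ (l - a).*2).
  by rewrite -{1 2}(subnKC le_al) doubleD !exprD invfM mulrACA.
by rewrite fconstM mulrACA.
Qed.

Lemma pcoef0 : pcoef 0 = psi.
Proof. by rewrite /pcoef double0 !expr0 divr1 fconst1 mul1r. Qed.

Lemma pcoef_bounds l : [/\ fps_le 0 (pcoef l), fps_le (pcoef l) (psi ^+ l.+1)
  & fps_le (psi ^+ l.+1 - fconst (l%:R / 12) * psi ^+ l) (pcoef l)].
Proof. exact: alternating_renewal_bounds psi_ge0 psi0 pcoef0 pcoefS l. Qed.

Lemma pcoef_ge0 l : fps_le 0 (pcoef l). Proof. by case: (pcoef_bounds l). Qed.
Lemma pcoef_le l : fps_le (pcoef l) (psi ^+ l.+1).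
Proof. by case: (pcoef_bounds l). Qed.
Lemma pcoef_ge l :
  fps_le (psi ^+ l.+1 - fconst (l%:R / 12) * psi ^+ l) (pcoef l).
Proof. by case: (pcoef_bounds l). Qed.

Lemma phi2_le l n : (-1) ^+ l / L ^+ l.*2 * (phi ^+ 2) l.*2 n <= l.+1%:R * (psi ^+ l.+2) n.
Proof.
rewrite pcoef_square mulr_natl -[X in _ *+ X]card_ord -sumr_const ler_sum // => a _.
have -> : psi ^+ l.+2 = psi ^+ a.+1 * psi ^+ (l - a).+1.
  by rewrite -exprD; congr (_ ^+ _); have := leq_ord a; lia.
apply: (fps_le_trans (fps_le_mul2l (@pcoef_ge0 _) (@pcoef_le _))).
by apply: fps_le_mul2r (@pcoef_le _); apply/fps_ge0_exp/psi_ge0.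
Qed.

Lemma phi2_ge0 l n : 0 <= (-1) ^+ l / L ^+ l.*2 * (phi ^+ 2) l.*2 n.
Proof.
rewrite pcoef_square sumr_ge0 // => a _.
exact: (fps_ge0_mul (@pcoef_ge0 _) (@pcoef_ge0 _)).
Qed.

Lemma phi2_ge l n :
  l.+1%:R * ((psi ^+ l.+2) n - l%:R / 12 * (psi ^+ l.+1) n)
  <= (-1) ^+ l / L ^+ l.*2 * (phi ^+ 2) l.*2 n.
Proof.
rewrite pcoef_square mulr_natl -[X in _ *+ X]card_ord -sumr_const ler_sum // => a _.
have le_al := leq_ord a.
have e1 : psi ^+ l.+2 = psi ^+ a.+1 * psi ^+ (l - a).+1.
  by rewrite -exprD; congr (_ ^+ _); lia.
have e2 : psi ^+ l.+1 = psi ^+ a.+1 * psi ^+ (l - a).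
  by rewrite -exprD; congr (_ ^+ _); lia.
have e3 : psi ^+ l.+1 = psi ^+ a * psi ^+ (l - a).+1.
  by rewrite -exprD; congr (_ ^+ _); lia.
have psiX k : fps_le 0 (psi ^+ k) by apply/fps_ge0_exp/psi_ge0.
have l12 : 0 <= (l - a)%:R / 12 :> R by rewrite divr_ge0.
(* The corrections a/12 and (l-a)/12 of the two factors add up to l/12 for every [a]. *)
have := fps_le_mul_lower l12 (pcoef_ge0 a) (psiX _) (psiX _) (pcoef_le a) (pcoef_ge a)
  (pcoef_ge (l - a)) n.
rewrite -e1 -e2 -e3; apply: le_trans.
move: ((psi ^+ l.+2) n) ((psi ^+ l.+1) n) => x z.
by rewrite -mulrDl -mulrDl -natrD subnKC.
Qed.

End CoefficientBounds.

(** * Convolutions and dominated convergence *)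

Local Open Scope classical_set_scope.

Section Convolution.
Variable R : realType.
Implicit Types (f g b : fps R).

Lemma cvg_sum_ord (A : nat -> nat -> R) (a : nat -> R) K :
  (forall j, A n j @[n --> \oo] --> a j) ->
  \sum_(j < K) A n j @[n --> \oo] --> \sum_(j < K) a j.
Proof.
move=> Aa; elim: K => [|K IH].
  rewrite big_ord0; under eq_fun do rewrite big_ord0; exact: cvg_cst.
rewrite big_ord_recr /=; under eq_fun do rewrite big_ord_recr /=.
exact: cvgD.
Qed.

Lemma tannery (A : nat -> nat -> R) (a B : nat -> R) (l : R) (m : nat -> nat) :
  m n @[n --> \oo] --> \oo -> (forall n j, (j < m n)%N -> `|A n j| <= B j) ->
  cvgn (series B) -> (forall j, A n j @[n --> \oo] --> a j) ->
  series a @ \oo --> l ->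
  \sum_(j < m n) A n j @[n --> \oo] --> l.
Proof.
move=> m_oo AB Bc Aa al; apply/cvgrPdist_lt => e e0.
have e3 : 0 < e / 3 by rewrite divr_gt0.
have [K1 _ K1P] : \forall n \near \oo, `|l - series a n| < e / 3.
  by move/cvgrPdist_lt: al; apply.
(* A stretch of the series is a difference of two partial sums, hence half the tolerance for
   each. *)
have [K2 _ K2P] : \forall n \near \oo, `|limn (series B) - series B n| < e / 3 / 2.
  by move/cvgrPdist_lt: Bc; apply; rewrite divr_gt0.
pose K := maxn K1 K2.
have tailB M : (K <= M)%N -> \sum_(K <= j < M) B j < e / 3.
  move=> KM; have := K2P M (leq_trans (leq_maxr _ _) KM).
  have := K2P K (leq_maxr _ _); rewrite /= !ltr_norml.
  have -> : series B M = series B K + \sum_(K <= j < M) B j.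
    by rewrite /series /= -big_cat_nat.
  lra.
have AK := cvg_sum_ord (K := K) Aa.
near=> n.
have Kmn : (K <= m n)%N by near: n; move/cvgnyPge: m_oo; apply.
have -> : \sum_(j < m n) A n j = \sum_(j < K) A n j + \sum_(K <= j < m n) A n j.
  by rewrite -!(big_mkord xpredT (A n)) -big_cat_nat.
have h1 : `|\sum_(j < K) a j - \sum_(j < K) A n j| < e / 3.
  by near: n; move/cvgrPdist_lt: AK; apply.
have h2 : `|l - \sum_(j < K) a j| < e / 3.
  have := K1P K (leq_maxl _ _); by rewrite /= /series /= big_mkord.
have h3 : `|\sum_(K <= j < m n) A n j| < e / 3.
  apply: le_lt_trans (tailB _ Kmn); apply: le_trans (ler_norm_sum _ _ _) _.
  rewrite !big_nat; apply: ler_sum => j /andP[_ jm]; exact: AB.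
move: h1 h2 h3; rewrite !ltr_norml; lra.
Unshelve. all: by end_near.
Qed.

(** The k-th term of the convolution, divided by [w n], tends to [b k * alpha] since shifting [w]
    does not matter in the limit. As [w] is nondecreasing, a bound on [g / w] dominates the terms by
    a multiple of [|b k|]. *)
Lemma convolution_cvg b g (w : nat -> R) (beta alpha : R) :
  (forall n, 0 < w n) -> (forall n, w n <= w n.+1) ->
  w n / w n.+1 @[n --> \oo] --> (1 : R) ->
  cvgn (series (fun k => `|b k|)) -> series b @ \oo --> beta ->
  g n / w n @[n --> \oo] --> alpha ->
  (b * g) n / w n @[n --> \oo] --> beta * alpha.
Proof.
move=> w0 wS w1 babs bsum glim.
have wle i j : (i <= j)%N -> w i <= w j.
  elim: j => [|j IH]; first by rewrite leqn0 => /eqP ->.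
  by rewrite leq_eqVlt => /predU1P[-> //|/IH] /le_trans; apply.
have gk k : g (n - k)%N / w n @[n --> \oo] --> alpha.
  elim: k => [|k IH]; first by under eq_fun do rewrite subn0.
  rewrite -(cvg_shiftS (fun n => g (n - k.+1)%N / w n)) -[alpha]mulr1.
  have -> : [sequence g (n.+1 - k.+1)%N / w n.+1]_n =
      (fun n => (g (n - k)%N / w n) * (w n / w n.+1)).
    apply/funext => n /=; rewrite subSS mulrA divfK //; exact: lt0r_neq0.
  exact: cvgM.
have [M M0 gM] : exists2 M, 0 <= M & forall n, `|g n / w n| <= M.
  have /cvgP/cvg_seq_bounded := glim.
  rewrite /bounded_fun /bounded_near => -[M0 [_ /(_ (`|M0| + 1))]].
  rewrite (le_lt_trans (ler_norm _)) ?ltrDl // => /(_ isT) P.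
  by exists (`|M0| + 1) => [|n]; [rewrite addr_ge0 | exact: P].
have -> : (fun n => (b * g) n / w n)
    = (fun n => \sum_(k < n.+1) b k * (g (n - k)%N / w n)).
  apply/funext => n; rewrite fcoefM mulr_suml.
  by apply: eq_bigr => k _; rewrite mulrA.
apply: (tannery (A := fun n k => b k * (g (n - k)%N / w n))
  (a := fun k => b k * alpha) (B := fun k => `|b k| * M)).
- by apply/cvgnyPge => K; exists K => // n /= Kn; apply: leqW.
- move=> n k _; rewrite normrM ler_wpM2l // (le_trans _ (gM (n - k)%N)) //.
  rewrite !normrM ler_wpM2l // !gtr0_norm ?invr_gt0 //.
  by rewrite lef_pV2 ?posrE // wle // leq_subr.
- have -> : series (fun k => `|b k| * M) = (fun n => series (fun k => `|b k|) n * M).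
    by apply/funext => n; rewrite /series /= mulr_suml.
  exact: is_cvgMl.
- by move=> k; apply: cvgM; [exact: cvg_cst | exact: gk].
- have -> : series (fun k => b k * alpha) = (fun n => series b n * alpha).
    by apply/funext => n; rewrite /series /= mulr_suml.
  by apply: cvgM => //; exact: cvg_cst.
Qed.

(** This is 1 / (1 - X): multiplying by it takes partial sums, and its powers serve as weights for
    the growth of coefficients. *)
Definition fones : fps R := Fps (fun=> 1).
Definition fX : fps R := Fps (fun n => (n == 1%N)%:R).

Lemma fonesM f n : (fones * f) n = \sum_(i < n.+1) f i.
Proof. by rewrite mulrC fcoefM; apply: eq_bigr => i _; rewrite mulr1. Qed.

Lemma fonesMS f n : (fones * f) n.+1 = (fones * f) n + f n.+1.
Proof. by rewrite !fonesM big_ord_recr. Qed.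

Lemma fXM f n : (fX * f) n.+1 = f n.
Proof.
rewrite fcoefM big_ord_recl mul0r add0r big_ord_recl lift0 mul1r subSS subn0.
by rewrite big1 ?addr0 // => i _; rewrite !lift0 mul0r.
Qed.

Lemma fonesK : (1 - fX) * fones = 1.
Proof.
apply: fpsP => -[|n].
  by rewrite fcoefM0 fcoefB fcoef1 /= subr0 mulr1.
by rewrite mulrBl mul1r fcoefB fXM fcoef1 subrr.
Qed.

Lemma series_fones f : (fun n => series f n.+1) = fones * f :> (nat -> R).
Proof. by apply/funext => n; rewrite fonesM /series /= big_mkord. Qed.

Lemma cvg_fones f (l : R) : series f @ \oo --> l <-> (fones * f) n @[n --> \oo] --> l.
Proof. by rewrite -series_fones (cvg_shiftS (series f)). Qed.

Lemma fonesX T n : (fones ^+ T.+1) n = 'C(n + T, T)%:R.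
Proof.
elim: T n => [|T IH] n; first by rewrite expr1 bin0.
rewrite exprS; elim: n => [|n IHn].
  by rewrite fonesM big_ord1 IH !add0n !binn.
by rewrite fonesMS IHn IH -natrD addSnnS -[in RHS]addSnnS addSn binS addSnnS.
Qed.

Lemma fonesX_gt0 T n : 0 < (fones ^+ T.+1) n.
Proof. by rewrite fonesX ltr0n bin_gt0 leq_addl. Qed.

Lemma fonesX_nondecreasing T n : (fones ^+ T.+1) n <= (fones ^+ T.+1) n.+1.
Proof. by rewrite !fonesX ler_nat leq_bin2l // leq_add2r. Qed.

Lemma fonesX_ratio T n :
  (fones ^+ T.+1) n / (fones ^+ T.+1) n.+1 = n.+1%:R / (n.+1 + T)%:R.
Proof.
have := fonesX_gt0 T n.+1; rewrite !fonesX => /lt0r_neq0 h.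
have h2 : (n.+1 + T)%:R != 0 :> R by rewrite addSn pnatr_eq0.
apply/eqP; rewrite eqr_div // -!natrM eqr_nat; apply/eqP.
have F : (0 < T`! * n.+1`!)%N by rewrite muln_gt0 !fact_gt0.
have e1 := bin_fact (leq_addl n T); have e2 := bin_fact (leq_addl n.+1 T).
rewrite !addnK in e1 e2; apply/eqP; rewrite -(eqn_pmul2r F); apply/eqP.
transitivity (n.+1 * (n.+1 + T) * (n + T)`!)%N.
  rewrite -e1 factS; nia.
rewrite addSn -mulnA -factS -addSn -e2; nia.
Qed.

Lemma inv_succ_cvg (T : nat) (c : R) : c / (n.+1 + T)%:R @[n --> \oo] --> (0 : R).
Proof.
rewrite -[X in _ --> X](mulr0 c); apply: cvgM; first exact: cvg_cst.
have -> : (fun n => (n.+1 + T)%:R^-1) = [sequence (harmonic (n + T)%N : R)]_n.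
  by apply/funext => n; rewrite /= addSn.
by rewrite cvg_shiftn; exact: cvg_harmonic.
Qed.

Lemma fonesX_ratio_cvg T :
  (fones ^+ T.+1) n / (fones ^+ T.+1) n.+1 @[n --> \oo] --> (1 : R).
Proof.
have -> : (fun n => (fones ^+ T.+1) n / (fones ^+ T.+1) n.+1)
    = (fun n => 1 - T%:R / (n.+1 + T)%:R).
  apply/funext => n; rewrite fonesX_ratio.
  have h : (n.+1 + T)%:R != 0 :> R by rewrite addSn pnatr_eq0.
  by apply: (mulIf h); rewrite mulrBl !divfK // mul1r natrD addrK.
rewrite -[X in _ --> X]subr0; apply: cvgB; [exact: cvg_cst | exact: inv_succ_cvg].
Qed.

Lemma fonesX_pred_cvg T :
  (fones ^+ T.+1) n / (fones ^+ T.+2) n @[n --> \oo] --> (0 : R).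
Proof.
have -> : (fun n => (fones ^+ T.+1) n / (fones ^+ T.+2) n)
    = (fun n => T.+1%:R / (n.+1 + T)%:R); last exact: inv_succ_cvg.
apply/funext => n; have := fonesX_gt0 T.+1 n; rewrite !fonesX => /lt0r_neq0 h.
apply/eqP; rewrite eqr_div //; last by rewrite addSn pnatr_eq0.
rewrite -!natrM eqr_nat addnS addSn mulnC; apply/eqP.
exact: mul_bin_diag (n + T).+1 T.
Qed.

Lemma fonesX_mulX_cvg b (beta : R) T t :
  cvgn (series (fun k => `|b k|)) -> series b @ \oo --> beta ->
  (fones ^+ T.+1 * b ^+ t) n / (fones ^+ T.+1) n @[n --> \oo] --> beta ^+ t.
Proof.
move=> babs bsum; elim: t => [|t IH].
  rewrite !expr0 mulr1.
  have -> : (fun n => (fones ^+ T.+1) n / (fones ^+ T.+1) n) = (fun=> 1).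
    by apply/funext => n; rewrite divff // lt0r_neq0 ?fonesX_gt0.
  exact: cvg_cst.
rewrite (exprS b) (exprS beta) mulrCA.
apply: convolution_cvg => //; [exact: fonesX_gt0 | exact: fonesX_nondecreasing |].
exact: fonesX_ratio_cvg.
Qed.

Lemma fones_mul_cvg b g (beta alpha : R) :
  cvgn (series (fun k => `|b k|)) -> series b @ \oo --> beta ->
  g n @[n --> \oo] --> alpha -> (b * g) n @[n --> \oo] --> beta * alpha.
Proof.
move=> babs bsum glim.
have -> : (fun n => (b * g) n) = (fun n => (b * g) n / 1).
  by apply/funext => n; rewrite divr1.
apply: (@convolution_cvg b g (fun=> 1)) => //.
  by rewrite divr1; exact: cvg_cst.
by under eq_fun do rewrite divr1.
Qed.

End Convolution.

(** * Renewal asymptotics *)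

Section Renewal.
Variables (R : realType) (L : R).
Hypotheses (L_gt0 : 0 < L) (L_lt1 : L < 1).
Hypothesis expL : series (fexp L) @ \oo --> (2 : R).
Variable psi : fps R.
Hypotheses (psiP : (2%:R - fexp L) * psi = 1) (psi_ge0 : fps_le 0 psi).

(* The coefficients of [q] are the tails of the renewal law [L ^ k / k!], [k > 0],
   whose mean is [2 L]. *)
Let q : fps R := (2%:R - fexp L) * fones R.

Lemma fexp_ge0 n : 0 <= fexp L n.
Proof. by rewrite /= divr_ge0 ?exprn_ge0 ?ler0n // ltW. Qed.

Lemma fexpS n : n.+1%:R * fexp L n.+1 = L * fexp L n.
Proof.
rewrite /= factS natrM exprS.
have h1 : n.+1%:R != 0 :> R by rewrite pnatr_eq0.
have h2 : n`!%:R != 0 :> R by rewrite pnatr_eq0 -lt0n fact_gt0.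
by field; rewrite h2 addrC natr1 h1.
Qed.

Lemma series_fexp_le n : series (fexp L) n <= 2.
Proof.
rewrite -(cvg_lim _ expL) //; apply: nondecreasing_cvgn_le; last exact/cvgP/expL.
by apply/nondecreasing_seqP => k; rewrite /series /= big_nat_recr //= lerDl fexp_ge0.
Qed.

Lemma tail_coef n : q n = 2 - series (fexp L) n.+1.
Proof.
by rewrite /q mulrC mulrBr fcoefB mulr_natr fcoefMn fonesM /series /= big_mkord.
Qed.

Lemma tail_ge0 n : 0 <= q n.
Proof. by rewrite tail_coef subr_ge0 series_fexp_le. Qed.

Lemma tailS n : q n.+1 = q n - fexp L n.+1.
Proof. by rewrite !tail_coef /series /= [in LHS]big_nat_recr //=; ring. Qed.

Lemma tail0 : q 0%N = 1.
Proof. by rewrite tail_coef /series /= big_nat1 expr0 fact0; lra. Qed.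

Lemma tail_cvg0 : q n @[n --> \oo] --> (0 : R).
Proof.
have -> : (fun n => q n) = (fun n => 2 - series (fexp L) n.+1).
  by apply/funext => n; rewrite tail_coef.
rewrite -[X in _ --> X](subrr (2 : R)); apply: cvgB; first exact: cvg_cst.
by rewrite (cvg_shiftS (series (fexp L))).
Qed.

(** Sum (n+2) L^k/k! <= k L^k/k! = L L^(k-1)/(k-1)! over k >= n+2; this is done on partial sums
    before passing to the limit. *)
Lemma tail_ratio_le n : n.+2%:R * q n.+1 <= L * q n.
Proof.
have partial m : n.+2%:R * (series (fexp L) (m + n.+2)%N - series (fexp L) n.+2)
    <= L * (series (fexp L) (m + n.+1)%N - series (fexp L) n.+1).
  elim: m => [|m IH]; first by rewrite !subrr !mulr0.
  have sS k : series (fexp L) k.+1 = series (fexp L) k + fexp L k.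
    by rewrite !seriesEnat /= big_nat_recr.
  have := fexpS (m + n.+1); rewrite -addnS => fS.
  have : n.+2%:R * fexp L (m + n.+2)%N <= (m + n.+2)%:R * fexp L (m + n.+2)%N.
    by rewrite ler_wpM2r ?fexp_ge0 // ler_nat leq_addl.
  by rewrite fS !addSn !sS !mulrBr !mulrDr in IH *; lra.
suff : n.+2%:R * (2 - series (fexp L) n.+2) <= L * q n by rewrite -tail_coef.
have lim : n.+2%:R * (series (fexp L) (m + n.+2)%N - series (fexp L) n.+2)
    @[m --> \oo] --> n.+2%:R * (2 - series (fexp L) n.+2).
  apply: cvgM; first exact: cvg_cst.
  by apply: cvgB; [rewrite (cvg_shiftn n.+2 (series (fexp L))) | exact: cvg_cst].
apply: (cvgr_to_le lim).
near=> m; apply: le_trans (partial m) _.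
by rewrite ler_pM2l // tail_coef lerD2r series_fexp_le.
Unshelve. all: by end_near.
Qed.

(** Summation by parts: the terms k L^k/k! = L L^(k-1)/(k-1)! for k up to n+1 add up to the last
    summand. *)
Lemma tail_sum n : (fones R * q) n = n.+1%:R * q n.+1 + L * (2 - q n).
Proof.
elim: n => [|n IH].
  have f1 : fexp L 1%N = L by rewrite /= expr1 divr1.
  by rewrite fonesM big_ord1 tailS tail0 f1; lra.
by rewrite fonesMS IH (tailS n.+1) -(natr1 n.+1); have := fexpS n.+1; rewrite tailS; lra.
Qed.

Lemma tail_sum_le n : (fones R * q) n <= 2 * L.
Proof.
rewrite tail_sum; have := tail_ratio_le n; have := tail_ge0 n.+1; rewrite -(natr1 n.+1); lra.
Qed.

Lemma tail_series : series q @ \oo --> 2 * L.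
Proof.
apply/cvg_fones.
have -> : (fun n => (fones R * q) n) = (fun n => n.+1%:R * q n.+1 + L * (2 - q n)).
  by apply/funext => n; rewrite tail_sum.
rewrite -[2 * L]add0r; apply: cvgD.
  apply: (@squeeze_cvgr _ _ _ _ (fun=> 0) (fun n => L * q n)).
  - near=> n; have := tail_ratio_le n; have := tail_ge0 n.+1; rewrite -(natr1 n.+1) => h1 h2.
    by rewrite mulr_ge0 ?tail_ge0 //; apply: le_trans h2; rewrite mulrDl; lra.
  - exact: cvg_cst.
  - rewrite -[X in _ --> X](mulr0 L); apply: cvgM; [exact: cvg_cst | exact: tail_cvg0].
rewrite mulrC; apply: cvgM; first exact: cvg_cst.
rewrite -[X in _ --> X]subr0; apply: cvgB; [exact: cvg_cst | exact: tail_cvg0].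
Unshelve. all: by end_near.
Qed.

(** The first differences of the renewal sequence [psi]; as a series it is the inverse of [q]. *)
Definition renewal_diff : fps R := (1 - fX R) * psi.
Let b := renewal_diff.

Lemma fones_renewal_diff : fones R * b = psi.
Proof. by rewrite /b /renewal_diff mulrA [fones R * _]mulrC fonesK mul1r. Qed.

Lemma renewal_diff_tail : b * q = 1.
Proof.
transitivity (((1 - fX R) * fones R) * ((2%:R - fexp L) * psi)).
  by rewrite /b /renewal_diff /q; ring.
by rewrite fonesK psiP mulr1.
Qed.

Lemma tail_psi : q * psi = fones R.
Proof.
rewrite -[RHS]mulr1 -psiP /q; ring.
Qed.

Lemma psi_le_fones : fps_le psi (fones R).
Proof.
move=> n; rewrite -tail_psi fcoefM big_ord_recl tail0 mul1r subn0 lerDl sumr_ge0 //.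
by move=> i _; rewrite mulr_ge0 ?tail_ge0 ?psi_ge0.
Qed.

(** From b = 1 - (q - 1) b, where [q - 1] is nonnegative of total mass 2 L - 1 < 1, the partial sums
    S of |b| satisfy S <= 1 + (2 L - 1) S, which bounds them by 1 / (2 - 2 L). *)
Lemma renewal_diff_abs : cvgn (series (fun k => `|b k|)).
Proof.
pose c : fps R := Fps (fun k => `|b k|).
have c0 : fps_le 0 c by move=> n /=.
have q1_ge0 : fps_le 0 (q - 1).
  move=> -[|n]; rewrite fcoefB fcoef1 ?tail0 ?subrr // subr0; exact: tail_ge0.
have c_le : fps_le c (1 + (q - 1) * c).
  move=> n; rewrite [c n](_ : _ = `|b n|) //.
  have -> : b n = (1 - (q - 1) * b) n.
    by congr (fcoef _ n); rewrite -{1}renewal_diff_tail; ring.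
  rewrite fcoefB; apply: (le_trans (ler_normB _ _)); apply: lerD.
    by rewrite fcoef1 normr_nat.
  rewrite !fcoefM; apply: le_trans (ler_norm_sum _ _ _) _; apply: ler_sum => i _.
  by rewrite normrM ger0_norm // q1_ge0.
pose S := fones R * c.
have f0 : fps_le 0 (fones R) by move=> n; rewrite ler01.
have S_mono i j : (i <= j)%N -> S i <= S j.
  elim: j => [|j IH]; first by rewrite leqn0 => /eqP ->.
  rewrite leq_eqVlt => /predU1P[-> //|/IH /le_trans]; apply.
  by rewrite /S fonesMS lerDl c0.
have S_le n : S n <= (2 - 2 * L)^-1.
  rewrite -[X in _ <= X]mul1r ler_pdivlMr; last by have := L_lt1; lra.
  suff : S n <= 1 + (2 * L - 1) * S n by lra.
  have : fps_le S (fones R + (q - 1) * S).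
    have -> : fones R + (q - 1) * S = fones R * (1 + (q - 1) * c) by rewrite /S; ring.
    exact: fps_le_mul2l f0 c_le.
  move=> /(_ n) /le_trans; apply; rewrite fcoefD lerD2l fcoefM.
  apply: (@le_trans _ _ (\sum_(i < n.+1) (q - 1) i * S n)).
    by apply: ler_sum => i _; rewrite ler_wpM2l ?q1_ge0 // S_mono // leq_subr.
  rewrite -mulr_suml ler_wpM2r //; first exact: fps_ge0_mul f0 c0 n.
  by rewrite -fonesM mulrBr fcoefB mulr1; apply: lerB; rewrite ?tail_sum_le ?lexx.
apply: nondecreasing_is_cvgn.
  by apply/nondecreasing_seqP => k; rewrite /series /= big_nat_recr //= lerDl.
exists (2 - 2 * L)^-1 => _ [n _ <-]; apply: le_trans (S_le n).
have -> : S n = series (fun k => `|b k|) n.+1.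
  by rewrite /S fonesM seriesEnat /= big_mkord.
by rewrite !seriesEnat /= big_nat_recr //= lerDl.
Qed.

(** The sum of [b] is the limit of [psi]. Passing to the limit in [q * psi = fones R], where [q] has
    sum 2 L, identifies it. *)
Lemma renewal_diff_series : series b @ \oo --> (2 * L)^-1.
Proof.
have bc : cvgn (series b) by apply: normed_cvg; exact: renewal_diff_abs.
pose beta := limn (series b); have bbeta : series b @ \oo --> beta by [].
have psi_lim : psi n @[n --> \oo] --> beta.
  by rewrite -fones_renewal_diff; apply/cvg_fones.
have qabs : cvgn (series (fun k => `|q k|)).
  have -> : (fun k => `|q k|) = q by apply/funext => k; rewrite ger0_norm ?tail_ge0.
  exact/cvgP/tail_series.
have := fones_mul_cvg qabs tail_series psi_lim; rewrite tail_psi => lim1.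
have E : 2 * L * beta = 1.
  by rewrite -(cvg_lim _ lim1) //; apply: cvg_lim => //; exact: cvg_cst.
have -> // : (2 * L)^-1 = beta.
by apply: (mulfI (_ : 2 * L != 0)); rewrite ?E ?divff // mulf_neq0 ?gt_eqF.
Qed.

Lemma psiX_cvg t :
  (psi ^+ t.+1) n / (fones R ^+ t.+1) n @[n --> \oo] --> (2 * L)^-1 ^+ t.+1.
Proof.
rewrite -fones_renewal_diff exprMn; apply: fonesX_mulX_cvg.
  exact: renewal_diff_abs.
exact: renewal_diff_series.
Qed.

Lemma psiX_le t n : (psi ^+ t) n <= (fones R ^+ t) n.
Proof.
elim: t n => [|t IH] n; first by rewrite !expr0.
rewrite !exprS; apply: (le_trans (fps_le_mul2l psi_ge0 IH n)).
apply: fps_le_mul2r psi_le_fones n; apply: fps_ge0_exp => k; exact: ler01.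
Qed.

End Renewal.

(** * The central binomial series *)

Section CentralBinomialSeries.
Variables (R : realType).

(** The expansion of (1 - X)^(-1/2). *)
Definition fcentral : fps R := Fps (fun j => 'C(j.*2, j)%:R / 4 ^+ j).

Lemma fcentralS j : 2 * j.+1%:R * fcentral j.+1 = (2 * j%:R + 1) * fcentral j.
Proof.
rewrite /= exprS.
have h4 : (4 : R) ^+ j != 0 by rewrite expf_neq0 // pnatr_eq0.
have E : (j.+1 * 'C(j.+1.*2, j.+1) = 2 * (j.*2.+1 * 'C(j.*2, j)))%N.
  have e1 := mul_bin_diag j.+1.*2 j; have e2 := mul_bin_diag j.*2.+1 j.
  have e3 : 'C(j.*2.+1, j) = 'C(j.*2.+1, j.+1).
    by rewrite -[RHS]bin_sub; [congr 'C(_, _); lia | lia].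
  rewrite doubleS /= in e1 *; rewrite /= in e2.
  by rewrite -e1 e3 -doubleS -muln2 e2 muln2; nia.
have {}E : j.+1%:R * 'C(j.+1.*2, j.+1)%:R = 2 * ((2 * j%:R + 1) * 'C(j.*2, j)%:R) :> R.
  by rewrite -natrM E !natrM -(natr1 j.*2) -mul2n natrM.
transitivity (2 * (j.+1%:R * 'C(j.+1.*2, j.+1)%:R) / (4 * 4 ^+ j) : R).
  by ring.
by rewrite E; field; rewrite h4.
Qed.

Lemma fcentral_sqr : fcentral * fcentral = fones R.
Proof.
(* [(1 - X) * fcentral ^ 2] has derivative zero. *)
have ode : 2%:R * ((1 - fX R) * fderiv fcentral) = fcentral.
  have dE k : fderiv fcentral k = k.+1%:R * fcentral k.+1 by rewrite mulr_natl.
  apply: fpsP => -[|j]; rewrite mulr_natl fcoefMn -mulr_natl.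
    rewrite fcoefM0 fcoefB fcoef1 dE [fX R 0%N](_ : _ = 0) //.
    rewrite eqxx; have := fcentralS 0.
    by move: (fcentral 0%N) (fcentral 1%N) => c0 c1; rewrite /= mulr1n; lra.
  rewrite mulrBl mul1r fcoefB fXM !dE; have := fcentralS j.+1.
  rewrite -(natr1 j.+1); move: (fcentral j.+1) (fcentral j.+2) => c1 c2; lra.
pose G := (1 - fX R) * (fcentral * fcentral).
have dX : fderiv (1 - fX R) = - 1.
  apply: fpsP => n; rewrite -[LHS]/((1 - fX R) n.+1 *+ n.+1).
  rewrite fcoefB fcoefN !fcoef1 sub0r /=.
  by case: n => [|n] //=; rewrite oppr0 mul0rn.
have dG : fderiv G = 0.
  rewrite /G !fderivM dX.
  transitivity (- (fcentral * fcentral)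
    + fcentral * (2%:R * ((1 - fX R) * fderiv fcentral))); first by ring.
  by rewrite ode addNr.
have G1 : G = 1.
  apply: fpsP => -[|n].
    by rewrite fcoefM0 fcoefM0 fcoefB fcoef1 /= expr0 divr1 subr0 !mulr1.
  have /(congr1 (fun f : fps R => f n)) := dG; rewrite /fderiv [LHS]/= => /eqP.
  by rewrite mulrn_eq0 /= => /eqP ->.
by rewrite -[RHS]mulr1 -G1 /G mulrA [fones R * _]mulrC fonesK mul1r.
Qed.

Lemma central_binomial_le j : 'C(j.*2, j)%:R <= (4 : R) ^+ j.
Proof.
rewrite -natrX ler_nat; have -> : (4 ^ j = (1 + 1) ^ j.*2)%N.
  by rewrite -mul2n expnM.
by rewrite expnDn (bigD1 (inord j)) //= inordK ?exp1n ?muln1 ?leq_addr // -addnn; lia.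
Qed.

(** By [fcentral_sqr] the series squares to the geometric series of [t]. Convolving it with its own
    partial sums thus shows that its sum [s >= 0] satisfies [s * s = (1 - t)^-1]. *)
Lemma central_binomial_series (t : R) : 0 < t -> t < 1 ->
  series (fun j => 'C(j.*2, j)%:R * (t / 4) ^+ j) @ \oo --> (Num.sqrt (1 - t))^-1.
Proof.
move=> t0 t1; pose f : fps R := Fps (fun j => 'C(j.*2, j)%:R * (t / 4) ^+ j).
have f_ge0 j : 0 <= f j by rewrite /= mulr_ge0 // exprn_ge0 // divr_ge0 // ltW.
have f_le j : f j <= geometric 1 t j.
  rewrite /= mul1r expr_div_n mulrCA ler_piMr ?exprn_ge0 ?(ltW t0) //.
  by rewrite ler_pdivrMr ?exprn_gt0 // mul1r central_binomial_le.
have t_norm : `|t| < 1 by rewrite gtr0_norm.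
have fc : cvgn (series f).
  apply: series_le_cvg f_ge0 _ f_le (is_cvg_geometric_series t_norm).
  by move=> n /=; rewrite mul1r exprn_ge0 // ltW.
pose s := limn (series f); have fs : series f @ \oo --> s by [].
have fabs : cvgn (series (fun k => `|f k|)).
  by have -> : (fun k => `|f k|) = f by apply/funext => k; rewrite ger0_norm.
have := fones_mul_cvg fabs fs ((cvg_fones f s).1 fs).
have -> : f * (fones R * f) = fones R * Fps (geometric 1 t).
  rewrite mulrCA; congr (_ * _); apply: fpsP => n /=.
  have /(congr1 (fun g : fps R => g n)) := fcentral_sqr; rewrite /= => E.
  rewrite mul1r -[RHS]mulr1 -[X in _ = _ * X]E mulr_sumr; apply: eq_bigr => i _.
  have -> : t ^+ n = t ^+ i * t ^+ (n - i) by rewrite -exprD subnKC // -ltnS.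
  by rewrite !expr_div_n; ring.
move=> lim1; have E : s * s = (1 - t)^-1.
  rewrite -(cvg_lim _ lim1) //; apply: cvg_lim => //.
  apply/cvg_fones; rewrite -[_^-1]mul1r.
  exact: cvg_geometric_series.
have s0 : 0 <= s.
  rewrite -(cvg_lim _ fs) //; apply: limr_ge; first exact: fc.
  by near=> n; rewrite seriesEnat /= sumr_ge0 // => i _; exact: f_ge0.
have sE : (Num.sqrt (1 - t))^-1 = s.
  by rewrite -sqrtrV ?subr_ge0 ?(ltW t1) // -E -expr2 sqrtr_sqr ger0_norm.
by rewrite sE; exact: fs.
Unshelve. all: by end_near.
Qed.

End CentralBinomialSeries.

(** * The limit *)

Section Ratios.
Variable R : realFieldType.
Implicit Types a b c k w x : R.

Lemma ratio_bounds a k w x :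
  0 < k -> 0 < w -> 0 <= x -> x <= k * a -> a <= w -> 0 <= x / (k * w) <= 1.
Proof.
move=> k0 w0 x0 xa aw; have kw : 0 < k * w by rewrite mulr_gt0.
rewrite divr_ge0 ?(ltW kw) // ler_pdivrMr // mul1r (le_trans xa) //.
by rewrite ler_pM2l.
Qed.

Lemma ratio_sandwich a b c k w x :
  0 < k -> 0 < w -> k * (a - c * b) <= x -> x <= k * a ->
  a / w - c * (b / w) <= x / (k * w) <= a / w.
Proof.
move=> k0 w0 lo hi; have kw : 0 < k * w by rewrite mulr_gt0.
have wE : w != 0 by rewrite gt_eqF.
rewrite ler_pdivlMr // ler_pdivrMr //.
have -> : a / w * (k * w) = k * a by field.
have -> : (a / w - c * (b / w)) * (k * w) = k * (a - c * b) by field.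
by rewrite lo hi.
Qed.
End Ratios.

(** * Normalized terms and their dominated convergence *)

Section Asymptotics.
Variables (R : realType) (L : R).
Hypotheses (L_gt0 : 0 < L) (L_sqr : 2 * L ^+ 2 < 1).
Hypothesis expL : series (fexp L) @ \oo --> (2 : R).

Let L_lt1 : L < 1.
Proof. by rewrite ltNge; apply/negP => L1; have := L_sqr; nra. Qed.

(** Two inversions: first the constant coefficient in delta, as a series in sigma, then the
    bivariate series over it. *)
Lemma exists_phi : exists phi, exc_den L * phi = 1.
Proof.
have [psi psiP] : exists psi, (2%:R - fexp L) * psi = 1.
  apply: (@fps_exists_inv _ _ 1).
  by rewrite mul1r fcoefB fcoef_nat fexp0E mulr1n; lra.
by apply: (@fps_exists_inv _ _ psi); rewrite exc_den_0 mulrC.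
Qed.

Variable phi : fps (fps R).
Hypothesis phiP : exc_den L * phi = 1.

Let psi := psi phi.
Let psiP : (2%:R - fexp L) * psi = 1 := psiP phiP.
Let psi_ge0 : fps_le 0 psi := psi_ge0 L_gt0 phiP.

(** The divisor is the upper bound [phi2_le] with [psi] replaced by its majorant [fones R]. *)
Definition phi2_ratio j n : R :=
  (-1) ^+ j / L ^+ j.*2 * (phi ^+ 2) j.*2 n / (j.+1%:R * (fones R ^+ j.+2) n).

Lemma phi2_ratio_bounds j n : 0 <= phi2_ratio j n <= 1.
Proof.
exact (ratio_bounds (ltr0Sn R j) (fonesX_gt0 R j.+1 n) (phi2_ge0 L_gt0 phiP j n)
  (phi2_le L_gt0 phiP j n) (psiX_le L_gt0 expL psiP psi_ge0 j.+2 n)).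
Qed.

Lemma phi2_ratio_sandwich j n :
  (psi ^+ j.+2) n / (fones R ^+ j.+2) n
    - j%:R / 12 * ((psi ^+ j.+1) n / (fones R ^+ j.+2) n)
  <= phi2_ratio j n <= (psi ^+ j.+2) n / (fones R ^+ j.+2) n.
Proof.
exact (ratio_sandwich (ltr0Sn R j) (fonesX_gt0 R j.+1 n)
  (phi2_ge L_gt0 phiP j n) (phi2_le L_gt0 phiP j n)).
Qed.

(** The lower-order correction drops out: [psi ^+ j.+1] grows like [fones R ^+ j.+1], which is
    negligible against [fones R ^+ j.+2]. *)
Lemma phi2_ratio_cvg j : phi2_ratio j n @[n --> \oo] --> (2 * L)^-1 ^+ j.+2.
Proof.
have lim1 k : (psi ^+ k.+1) n / (fones R ^+ k.+1) n @[n --> \oo]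
    --> (2 * L)^-1 ^+ k.+1.
  exact (@psiX_cvg _ _ L_gt0 L_lt1 expL _ psiP k).
have lim2 : (psi ^+ j.+1) n / (fones R ^+ j.+2) n @[n --> \oo] --> (0 : R).
  have -> : (fun n => (psi ^+ j.+1) n / (fones R ^+ j.+2) n)
    = (fun n => ((psi ^+ j.+1) n / (fones R ^+ j.+1) n)
               * ((fones R ^+ j.+1) n / (fones R ^+ j.+2) n)).
    apply/funext => n; rewrite mulrA divfK //.
    exact/lt0r_neq0/fonesX_gt0.
  rewrite -[X in _ --> X](mulr0 ((2 * L)^-1 ^+ j.+1)).
  by apply: cvgM; [exact: lim1 | exact: fonesX_pred_cvg].
apply: (@squeeze_cvgr _ _ _ _ _ _ _ _ _ _ (lim1 j.+1)).
  by near=> n; exact: phi2_ratio_sandwich.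
rewrite -[X in _ --> X]subr0 -[X in _ - X](mulr0 (j%:R / 12)).
by apply: cvgB; [exact: lim1 | apply: cvgM; [exact: cvg_cst | exact: lim2]].
Unshelve. all: by end_near.
Qed.

Definition ffact_ratio j N : R :=
  'C(j.*2, j)%:R * ((N./2 ^_ j)%:R / (N.+1 ^_ j)%:R).

Lemma ffact_half_le j N : (2 ^ j * (N./2 ^_ j) <= N.+1 ^_ j)%N.
Proof.
elim: j => // j IH; rewrite !ffactnSr expnS.
have h : (2 * (N./2 - j) <= N.+1 - j)%N by have := odd_double_half N; lia.
by apply: leq_trans (leq_mul IH h); nia.
Qed.

Lemma ffact_ratio_cvg j : ffact_ratio j N @[N --> \oo] --> ('C(j.*2, j)%:R / 2 ^+ j : R).
Proof.
apply: cvgM; first exact: cvg_cst.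
elim: j => [|j IH].
  under eq_fun do rewrite !ffactn0 divr1.
  by rewrite expr0 invr1; exact: cvg_cst.
rewrite exprSr invfM.
have -> : (fun N => (N./2 ^_ j.+1)%:R / (N.+1 ^_ j.+1)%:R : R)
  = (fun N => ((N./2 ^_ j)%:R / (N.+1 ^_ j)%:R) * ((N./2 - j)%:R / (N.+1 - j)%:R)).
  by apply/funext => N; rewrite !ffactnSr !natrM invfM mulrACA.
apply: cvgM => //.
apply: (@squeeze_cvgr _ _ _ _ (fun N => 2^-1 - (j.+2)%:R / (N.+1 - j)%:R) (fun=> 2^-1)).
- near=> N; have Nj : (j.*2 <= N)%N by near: N; exact: nbhs_infty_ge.
  have d0 : 0 < (N.+1 - j)%:R :> R by rewrite ltr0n; lia.
  rewrite ler_pdivlMr // ler_pdivrMr // mulrBl divfK ?gt_eqF //.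
  have -> : 2^-1 * (N.+1 - j)%:R = (N.+1 - j)%:R / 2 :> R by rewrite mulrC.
  have h := odd_double_half N.
  have h1 : (2 * (N./2 - j) <= N.+1 - j)%N by lia.
  have h2 : (N.+1 - j <= 2 * (N./2 - j) + j.+2.*2)%N by lia.
  move: h1 h2; rewrite -!(ler_nat R) natrD !natrM -mul2n natrM; lra.
- rewrite -[X in _ --> X]subr0; apply: cvgB; first exact: cvg_cst.
  rewrite -(cvg_shiftn j (fun N => j.+2%:R / (N.+1 - j)%:R : R)).
  have -> : [sequence j.+2%:R / ((n + j).+1 - j)%:R : R]_n
      = (fun n => j.+2%:R / (n.+1 + 0)%:R : R).
    by apply/funext => n /=; rewrite addn0 -addSn addnK.
  exact: inv_succ_cvg.
- exact: cvg_cst.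
Unshelve. all: by end_near.
Qed.

(** The j-th term of [bras_count_fps] times 4 L^2 / (N+1)!, with its factorials regrouped by
    [exc_term_factorials]. *)
Definition exc_term N j : R :=
  4 * L ^+ 2 * L ^+ j.*2 * ffact_ratio j N * phi2_ratio j (N - j.*2).

Lemma exc_term_cvg j :
  exc_term N j @[N --> \oo] --> 'C(j.*2, j)%:R * (L / 4) ^+ j.
Proof.
have -> : 'C(j.*2, j)%:R * (L / 4) ^+ j
  = 4 * L ^+ 2 * L ^+ j.*2 * ('C(j.*2, j)%:R / 2 ^+ j) * (2 * L)^-1 ^+ j.+2.
  have E4 : (4 : R) ^+ j = 2 ^+ j * 2 ^+ j by rewrite -exprMn -natrM.
  rewrite expr_div_n E4 -(addnn j) -(addn2 j) [L ^+ (j + j)]exprD exprD exprVn.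
  rewrite exprMn.
  have h2 : (2 : R) ^+ j != 0 by rewrite expf_neq0 // pnatr_eq0.
  have hL : L ^+ j != 0 by rewrite expf_neq0 // gt_eqF.
  by field; rewrite h2 hL gt_eqF.
apply: cvgM.
  by apply: cvgM; [exact: cvg_cst | exact: ffact_ratio_cvg].
by rewrite (cvg_centern j.*2 (phi2_ratio j)); exact: phi2_ratio_cvg.
Qed.

Lemma exc_term_le N j : `|exc_term N j| <= geometric (4 * L ^+ 2) (2 * L ^+ 2) j.
Proof.
have /andP[y0 y1] := phi2_ratio_bounds j (N - j.*2).
have c0 : 0 <= 4 * L ^+ 2 * L ^+ j.*2 by rewrite !mulr_ge0 ?exprn_ge0 ?ltW.
have f0 : 0 <= ffact_ratio j N by rewrite mulr_ge0 // divr_ge0.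
rewrite /exc_term ger0_norm; last by apply: mulr_ge0 => //; apply: mulr_ge0.
apply: (@le_trans _ _ (4 * L ^+ 2 * L ^+ j.*2 * ffact_ratio j N)).
  by rewrite ler_piMr // mulr_ge0.
have L2 n : 0 <= L ^+ n by rewrite exprn_ge0 // ltW.
have c2 : 0 <= 4 * L ^+ 2 by rewrite mulr_ge0.
rewrite /= exprMn -[X in X <= _]mulrA ler_wpM2l //.
rewrite -exprM mul2n mulrC ler_wpM2r //.
have F : (N./2 ^_ j)%:R / (N.+1 ^_ j)%:R <= (2 ^+ j)^-1 :> R.
  (* For j > N+1 the falling factorial is zero, and the quotient is zero by convention. *)
  have [->|F0] := posnP (N.+1 ^_ j); first by rewrite invr0 mulr0 invr_ge0 exprn_ge0.
  rewrite ler_pdivrMr ?ltr0n // mulrC ler_pdivlMr ?exprn_gt0 // -natrX -natrM.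
  by rewrite ler_nat mulnC ffact_half_le.
apply: (@le_trans _ _ (4 ^+ j * (2 ^+ j)^-1)).
  by apply: ler_pM => //; [rewrite divr_ge0 | exact: central_binomial_le].
have -> : (4 : R) = 2 * 2 by rewrite -natrM.
by rewrite exprMn mulfK // expf_neq0 ?pnatr_eq0.
Qed.

Lemma exc_term_sum_cvg :
  \sum_(j < N./2.+1) exc_term N j @[N --> \oo] --> (Num.sqrt (1 - L))^-1.
Proof.
apply: (tannery (B := geometric (4 * L ^+ 2) (2 * L ^+ 2)) _ _ _ exc_term_cvg).
- apply/cvgnyPge => K; exists K.*2 => // N /= KN.
  by have := odd_double_half N; lia.
- by move=> N j _; exact: exc_term_le.
- apply: is_cvg_geometric_series.
  by rewrite ger0_norm // mulr_ge0 // exprn_ge0 // ltW.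
- exact: central_binomial_series.
Qed.

(** Splits (N+1)! into a falling factorial and (N+1-j)!, the latter containing the coefficient
    binom(N-j+1, j+1) of (1 - X)^-(j+2) that normalizes [phi2_ratio]. *)
Lemma exc_term_factorials r N j : (j.*2 <= N)%N ->
  ('C(j.*2, j) * r ^_ j * N.+1`!
   = 'C(r, j) * ((N - j.*2)`! * j.*2`!)
     * (N.+1 ^_ j * (j.+1 * 'C(N - j.*2 + j.+1, j.+1))))%N.
Proof.
move=> jN.
have e1 : ('C(r, j) * j`! = r ^_ j)%N by exact: bin_ffact.
have e2 : (N.+1 ^_ j * (N.+1 - j)`! = N.+1`!)%N by apply: ffact_fact; lia.
have e3 : ('C(N - j.*2 + j.+1, j.+1) * (j.+1`! * (N - j.*2)`!) = (N.+1 - j)`!)%N.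
  have <- : (N - j.*2 + j.+1 = N.+1 - j)%N by lia.
  by have := bin_fact (leq_addl (N - j.*2) j.+1); rewrite addnK.
have e4 : ('C(j.*2, j) * (j`! * j`!) = j.*2`!)%N.
  have jj : (j <= j.*2)%N by lia.
  by have := bin_fact jj; have -> : (j.*2 - j = j)%N by lia.
rewrite -e1 -e2 -e3 -e4 factS; ring.
Qed.

Lemma count_bras_ratio N :
  (count_bras N.+1 ((N.+1 - 1) %/ 2))%:R / ((2 * L)^-1 ^+ N.+1 * N.+1`!%:R)
  = (2 * L)^-1 * \sum_(j < N./2.+1) exc_term N j.
Proof.
rewrite subn1 /= divn2; set r := N./2.
(* The number of letters a exceeds that of letters b by the parity of [N], so [bras_count_fps]
   applies with [e = odd N]. *)
have NE : (r + (r + odd N) = N)%N by have := odd_double_half N; rewrite -/r; lia.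
have := bras_count_fps phiP r (leq_b1 (odd N)); rewrite NE => E.
rewrite -{1}NE count_brasE.
have L2 : 2 * L != 0 by rewrite mulf_neq0 ?gt_eqF.
have F0 : N.+1`!%:R != 0 :> R by rewrite pnatr_eq0 -lt0n fact_gt0.
have -> : \sum_(j < r.+1) exc_term N j
  = 4 * L ^+ 2 / N.+1`!%:R * ((2 * L) ^+ N * (bras_count 0 r (r + odd N))%:R).
  rewrite E mulr_sumr; apply: eq_bigr => j _.
  have jN : (j.*2 <= N)%N by have := ltn_ord j; lia.
  rewrite /exc_term /ffact_ratio /phi2_ratio fonesX -[_ *+ (_ * _)%N]mulr_natr -/r.
  have : 'C(j.*2, j)%:R * (r ^_ j)%:R * N.+1`!%:R
      = 'C(r, j)%:R * ((N - j.*2)`! * j.*2`!)%:R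
        * ((N.+1 ^_ j)%:R * (j.+1%:R * 'C(N - j.*2 + j.+1, j.+1)%:R)) :> R.
    by rewrite -!natrM exc_term_factorials.
  have fN0 : (N.+1 ^_ j)%:R != 0 :> R by rewrite pnatr_eq0 -lt0n ffact_gt0; lia.
  have w0 : 'C(N - j.*2 + j.+1, j.+1)%:R != 0 :> R.
    by rewrite pnatr_eq0 -lt0n bin_gt0; lia.
  have j0 : j.+1%:R != 0 :> R by rewrite pnatr_eq0.
  have Lj : L ^+ j.*2 != 0 by rewrite expf_neq0 ?gt_eqF.
  move: F0 fN0 w0 j0 Lj; move: ((N - j.*2)`! * j.*2`!)%:R => F12.
  move: (N.+1`!%:R) (N.+1 ^_ j)%:R 'C(N - j.*2 + j.+1, j.+1)%:R => F fN w.
  move: j.+1%:R 'C(j.*2, j)%:R (r ^_ j)%:R 'C(r, j)%:R => j1 C2 rj Cr.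
  move: (fcoef (fcoef _ _) _) (L ^+ j.*2) ((-1) ^+ j) => Ph Lj sg.
  move=> F0 fN0 w0 j0 Lj0 K.
  transitivity (4 * L ^+ 2 * sg * Ph * (C2 * rj * F) / (fN * (j1 * w) * F)).
    by field; rewrite F0 w0 j0 fN0 Lj0.
  by rewrite K; field; rewrite F0 w0 j0 fN0.
rewrite exprVn exprS.
by field; rewrite expf_neq0 // F0 gt_eqF.
Qed.

End Asymptotics.

(** * Specialization to the logarithm of 2 *)

Section LogTwo.
Variable R : realType.

Lemma ln2_sqr : 2 * (ln (2 : R)) ^+ 2 < 1.
Proof.
have L0 : 0 < ln (2 : R) by rewrite ln_gt0 // ltr1n.
(* Indeed 2 (7/10)^2 = 0.98, and the first four terms of the exponential series at 7/10 already add
   up to more than 2.002. *)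
suff : ln (2 : R) < 7 / 10 by nra.
rewrite -ltr_expR lnK ?posrE //.
apply: (@lt_le_trans _ _ (series (exp_coeff (7 / 10 : R)) 4)).
  rewrite seriesEnat /= big_mkord !big_ord_recr big_ord0 /exp_coeff /=.
  rewrite (_ : 0`! = 1)%N // (_ : 1`! = 1)%N // (_ : 2`! = 2)%N // (_ : 3`! = 6)%N //.
  by rewrite expr0 expr1 expr2 exprS expr2; lra.
apply: nondecreasing_cvgn_le; last exact: is_cvg_series_exp_coeff.
apply/nondecreasing_seqP => k.
by rewrite !seriesEnat /= big_nat_recr //= lerDl divr_ge0 // exprn_ge0 // divr_ge0.
Qed.

Lemma count_bras_cvg :
  (count_bras n ((n - 1) %/ 2))%:R / ((2 * ln 2)^-1 ^+ n * n`!%:R)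
    @[n --> \oo] --> ((2 * ln 2 * Num.sqrt (1 - ln 2))^-1 : R).
Proof.
have L0 : 0 < ln (2 : R) by rewrite ln_gt0 // ltr1n.
have expL : series (fexp (ln (2 : R))) @ \oo --> (2 : R).
  rewrite -[X in _ --> X](@lnK R) ?posrE //; exact: is_cvg_series_exp_coeff.
have [phi phiP] := exists_phi (ln (2 : R)).
(* The exact formula [count_bras_ratio] concerns n = N+1, the words having N letters. *)
rewrite -(cvg_shiftS (fun n =>
  (count_bras n ((n - 1) %/ 2))%:R / ((2 * ln 2)^-1 ^+ n * n`!%:R))).
under eq_fun do rewrite /= (count_bras_ratio L0 ln2_sqr phiP).
rewrite invfM; apply: cvgM; first exact: cvg_cst.
exact: (exc_term_sum_cvg L0 ln2_sqr expL phiP).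
Qed.
End LogTwo.

From Stdlib Require Import Reals.
(* mathcomp binds the key R to ring_scope and Reals binds N to N_scope. *)
Delimit Scope R_scope with R.
Delimit Scope nat_scope with N.

Theorem theorem1p2 :
  Un_cv
    (fun n : nat =>
       (INR (count_bras n ((n - 1) %/ 2)%N)
        / ((/ (2 * ln 2)) ^ n * INR (n`!)))%R)
    (/ (2 * ln 2 * sqrt (1 - ln 2)))%R.
Proof.
have two : IZR 2 = 2 by rewrite IZRposE INRE.
move=> eps /RltP eps0.
(* The limit holds over any [realType]; here it is taken at the standard reals and its operations
   are translated. *)
have /cvgrPdist_lt /(_ eps eps0) [N _ NP] := @count_bras_cvg R.
exists N => n /ssrnat.leP /NP lim_n; apply/RltP.
by rewrite RdistE distrC !RlnE !INRE RpowE RsqrtE two.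
Qed.
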